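(* Let $\mathbb K$ be a field of characteristic $p>0$. The following three conditions are equivalent: (i) every finitely presented graded $\mathbb K$-algebra of linear growth has rational Hilbert series; (ii) every finitely presented graded $\mathbb K$-algebra of linear growth is automaton with respect to some degree-lexicographical order on the monomials in some finite homogeneous generating set; (iii) $\mathbb K$ is an algebraic extension of its prime subfield $\mathbb F_p$. In particular, if $\mathbb K$ is not algebraic over $\mathbb F_p$, there exists a finitely presented (indeed quadratic, $6$-generated) graded $\mathbb K$-algebra of linear growth whose Hilbert series is not rational.
   Context: All algebras are associative, unital, finitely generated, and $\mathbb Z$-graded of the form $A=A_0\oplus A_1\oplus\cdots$ with $A_0=\mathbb K$ (generators of positive degree). The Hilbert function is $h_A(n)=\dim A_n$ and the Hilbert series is $H_A(z)=\sum_{n\ge0}h_A(n)z^n$. $A$ has linear growth if $h_A$ is bounded. Given a finite set $S$ of homogeneous generators and an admissible order on words over $S$, a word is normal if it is not the leading word of any element of the ideal of relations of $A$ (in the free algebra on $S$); normal words form a basis of $A$. $A$ is automaton (with respect to $S$ and the order) if the set of normal words is a regular language. A degree-lexicographical order compares words first by degree (sum of degrees of letters) and then lexicographically with respect to a fixed total order on $S$. *)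

(* Defs.v *)
From HB Require Import structures.
From mathcomp Require Import all_boot all_order all_algebra.
Set Implicit Arguments. Unset Strict Implicit. Unset Printing Implicit Defensive.
Import Order.TTheory GRing.Theory Num.Theory.
Local Open Scope ring_scope.

Section NC.
Variable K : fieldType.

(* Words over the alphabet 'I_n; a noncommutative polynomial in K<x_0..x_(n-1)>
   is represented by a finite formal sum of terms (coefficient, word); two
   representations denote the same polynomial iff they have the same coefficient
   function [nccoef]. *)
Definition ncpoly (n : nat) := seq (K * seq 'I_n).

Definition nccoef n (p : ncpoly n) (w : seq 'I_n) : K :=
  \sum_(t <- p | t.2 == w) t.1.

Definition ncmul n (p q : ncpoly n) : ncpoly n :=
  [seq (t.1 * s.1, t.2 ++ s.2) | t <- p, s <- q].
Definition ncscale n (c : K) (p : ncpoly n) : ncpoly n :=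
  [seq (c * t.1, t.2) | t <- p].
Definition ncsub n (p q : ncpoly n) : ncpoly n := p ++ ncscale (-1) q.
Definition ncone n : ncpoly n := [:: (1, [::])].
Definition ncword n (w : seq 'I_n) : ncpoly n := [:: (1, w)].

Definition wdeg n (deg : 'I_n -> nat) (w : seq 'I_n) : nat :=
  (\sum_(x <- w) deg x)%N.

Definition homog n (deg : 'I_n -> nat) (e : nat) (p : ncpoly n) : Prop :=
  forall w, nccoef p w != 0 -> wdeg deg w = e.

Definition graded_pres n (deg : 'I_n -> nat) (R : seq (ncpoly n)) : Prop :=
  (forall i, (0 < deg i)%N) /\ (forall r, r \in R -> exists e, (0 < e)%N /\ homog deg e r).

Definition gen_term n (t : K * seq 'I_n * ncpoly n * seq 'I_n) : ncpoly n :=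
  let: (c, u, r, v) := t in ncmul (ncmul [:: (c, u)] r) (ncword v).

Definition in_ideal n (R : seq (ncpoly n)) (p : ncpoly n) : Prop :=
  exists ts : seq (K * seq 'I_n * ncpoly n * seq 'I_n),
    (forall t, t \in ts -> t.1.2 \in R) /\
    forall w, nccoef p w = nccoef (flatten (map (@gen_term n) ts)) w.

Definition lincomb n m (c : 'I_m -> K) (f : 'I_m -> ncpoly n) : ncpoly n :=
  flatten [seq ncscale (c i) (f i) | i <- enum 'I_m].

(* dim_K A_d = m for A = K<x>/(R): some m homogeneous degree-d polynomials
   form a basis of A_d modulo the ideal *)
Definition hilb_dim n (deg : 'I_n -> nat) (R : seq (ncpoly n)) (d m : nat) : Prop :=
  exists f : 'I_m -> ncpoly n,
    (forall i, homog deg d (f i)) /\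
    (forall c : 'I_m -> K, in_ideal R (lincomb c f) -> forall i, c i = 0) /\
    (forall g, homog deg d g -> exists c : 'I_m -> K, in_ideal R (ncsub g (lincomb c f))).

Definition is_hilb_fun n (deg : 'I_n -> nat) (R : seq (ncpoly n)) (h : nat -> nat) : Prop :=
  forall d, hilb_dim deg R d (h d).

Definition linear_growth n (deg : 'I_n -> nat) (R : seq (ncpoly n)) : Prop :=
  exists h, is_hilb_fun deg R h /\ exists C, forall d, (h d <= C)%N.

(* sum_d h(d) z^d is a rational function: Q * H = P for polynomials P, Q over Q, Q <> 0 *)
Definition rational_series (h : nat -> nat) : Prop :=
  exists P Q : {poly rat}, Q != 0 /\
    forall k, \sum_(i < k.+1) Q`_i * ((h (k - i)%N)%:R) = P`_k.

Definition rational_hilb n (deg : 'I_n -> nat) (R : seq (ncpoly n)) : Prop :=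
  exists h, is_hilb_fun deg R h /\ rational_series h.

Definition subst n m (s : 'I_m -> ncpoly n) (q : ncpoly m) : ncpoly n :=
  flatten [seq ncscale t.1 (foldr (fun k acc => ncmul (s k) acc) (ncone n) t.2) | t <- q].

Fixpoint lexle (s t : seq nat) : bool :=
  match s, t with
  | [::], _ => true
  | _ :: _, [::] => false
  | x :: s', y :: t' => (x < y)%N || ((x == y) && lexle s' t')
  end.

(* degree-lexicographic order on words over 'I_m, letters of degrees e and
   totally ordered by the injective rank rk *)
Definition deglex_le m (e : 'I_m -> nat) (rk : 'I_m -> nat) (w1 w2 : seq 'I_m) : bool :=
  (wdeg e w1 < wdeg e w2)%N ||
  ((wdeg e w1 == wdeg e w2) && lexle (map rk w1) (map rk w2)).

Definition regular_lang m (L : seq 'I_m -> Prop) : Prop :=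
  exists (Q : finType) (q0 : Q) (delta : Q -> 'I_m -> Q) (F : pred Q),
    forall w, L w <-> F (foldl delta q0 w).

Definition automaton n (deg : 'I_n -> nat) (R : seq (ncpoly n)) : Prop :=
  exists (m : nat) (e : 'I_m -> nat) (s : 'I_m -> ncpoly n) (rk : 'I_m -> nat),
    injective rk /\
    (forall k, (0 < e k)%N /\ homog deg (e k) (s k)) /\
    (forall i : 'I_n, exists q : ncpoly m, in_ideal R (ncsub (subst s q) (ncword [:: i]))) /\
    regular_lang (fun w : seq 'I_m =>
      (* w is normal: not the leading word of any element of the ideal of
         relations { q | q(s) = 0 in A } *)
      ~ exists q : ncpoly m,
          in_ideal R (subst s q) /\ nccoef q w != 0 /\
          forall w', nccoef q w' != 0 -> deglex_le e rk w' w).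

(* K is algebraic over its prime subfield {k 1_K | k in N} *)
Definition algebraic_over_prime_subfield : Prop :=
  forall x : K, exists P : {poly K},
    P != 0 /\ (forall i, exists k : nat, P`_i = k%:R) /\ root P x.

End NC.

(* Main.v *)
Require Import Defs.
From HB Require Import structures.
From mathcomp Require Import all_boot all_order all_algebra.
From mathcomp Require Import boolp.
From mathcomp Require Import zify ring.
Set Implicit Arguments. Unset Strict Implicit. Unset Printing Implicit Defensive.
Import Order.TTheory GRing.Theory Num.Theory.
Local Open Scope ring_scope.

(* (ii) => (i).  Normal words form a basis of the algebra and are closed under
   suffixes.  If they form a regular language, the numbers of words of degree d
   accepted from the reachable states satisfy a linear recurrence and are bounded,
   hence are eventually periodic.

   (iii) => (ii).  The coefficients of the relations are fixed by some power of the
   Frobenius map, so the ideal is stable under it; by uniqueness of normal forms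
   every coefficient of a normal form is fixed too, and only finitely many values
   occur.  In degree m, the matrices of left multiplication by the generators in the
   bases of normal words, and the normal words themselves, are determined by the
   same data in the degrees m - 1, ..., m - D, where D bounds the degrees of the
   generators and of the relations.  Bounded dimensions leave finitely many such
   windows, and a window together with the position of a normal word is a finite
   right-to-left state.

   (i) => (iii).  For t transcendental over F_p put lam = (1 + t, t, 1).  In the
   algebra on a, b, x, v_0, v_1, v_2 with v_k x = lam_k x v_k, a (v_0 - v_1 - v_2) = 0,
   v_0 b = v_1 b = v_2 b and every word killed that is not of the shape
   a? x* v_k? x* b?, the space spanned by the words a v_k x^N b is nonzero
   exactly when (1 + t)^N - t^N - 1 = 0, that is, when N is a power of p; all other
   components have constant dimension. *)

(** * Noncommutative polynomials and ideals *)

(** The heart of (iii) => (ii) is that a window determines the next degree. Matching the k-th normal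
    words of two windows gives linear maps that commute with left multiplications as long as degrees
    stay inside the window; keeping the first letter of a word and mapping its tail extends them to
    the next degree. A multiple [u r v] with [u] nonempty dies in the tail. With [u] empty, the
    letters of [r] after the first pass through the map one by one, which stays within the window
    because [D] bounds the degree of [r]. No Groebner basis is computed; it may well be infinite. In
    the counterexample a v_k x^N b = lam_k^N a x^N v_2 b, so the left relation multiplies a x^N v_2
    b by lam_0^N - lam_1^N - lam_2^N. That nothing else collapses is shown by functionals, realised
    as weighted automata, which are dual to the spanning words. *)

Section Polynomials.
Variables (K : fieldType) (n : nat).
Implicit Types (p q r : ncpoly K n) (u v w : seq 'I_n) (phi : seq 'I_n -> K).

(** A formal sum has no canonical form, so it is observed through linear functionals; identities
    between polynomials become ring identities between values of [lin]. *)
Definition lin phi p : K := \sum_(t <- p) t.1 * phi t.2.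

Definition peq p q := forall phi, lin phi p = lin phi q.

Definition mulw u v p : ncpoly K n := [seq (t.1, u ++ t.2 ++ v) | t <- p].

Definition comb T (s : seq T) (c : T -> K) (f : T -> ncpoly K n) : ncpoly K n :=
  flatten [seq ncscale (c i) (f i) | i <- s].

Lemma lin_nil phi : lin phi [::] = 0.
Proof. by rewrite /lin big_nil. Qed.

Lemma lin_cons phi t p : lin phi (t :: p) = t.1 * phi t.2 + lin phi p.
Proof. by rewrite /lin big_cons. Qed.

Lemma lin_cat phi p q : lin phi (p ++ q) = lin phi p + lin phi q.
Proof. by rewrite /lin big_cat. Qed.

Lemma lin_scale phi c p : lin phi (ncscale c p) = c * lin phi p.
Proof.
by rewrite /lin big_map mulr_sumr; apply: eq_bigr => t _; rewrite /= mulrA.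
Qed.

Lemma lin_sub phi p q : lin phi (ncsub p q) = lin phi p - lin phi q.
Proof. by rewrite lin_cat lin_scale mulN1r. Qed.

Lemma lin_word phi w : lin phi (ncword K w) = phi w.
Proof. by rewrite /lin big_seq1 mul1r. Qed.

Lemma lin_mulw phi u v p :
  lin phi (mulw u v p) = lin (fun w => phi (u ++ w ++ v)) p.
Proof. by rewrite /lin big_map. Qed.

Lemma lin_comb phi T (s : seq T) c f :
  lin phi (comb s c f) = \sum_(i <- s) c i * lin phi (f i).
Proof.
elim: s => [|i s IH]; first by rewrite big_nil lin_nil.
by rewrite big_cons -IH -lin_scale -lin_cat.
Qed.

Lemma lin_lincomb phi m (c : 'I_m -> K) f :
  lin phi (lincomb c f) = \sum_i c i * lin phi (f i).
Proof. by rewrite (lin_comb phi (enum 'I_m)) big_enum. Qed.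

Lemma lin_ncmul phi p q :
  lin phi (ncmul p q) = lin (fun u => lin (fun v => phi (u ++ v)) q) p.
Proof.
rewrite /lin /ncmul big_allpairs_dep; apply: eq_bigr => t _.
by rewrite mulr_sumr; apply: eq_bigr => s _; rewrite mulrA.
Qed.

Lemma eq_lin phi psi p : phi =1 psi -> lin phi p = lin psi p.
Proof. by move=> e; apply: eq_bigr => t _; rewrite e. Qed.

Lemma lin_linear phi psi c p :
  lin (fun w => c * phi w + psi w) p = c * lin phi p + lin psi p.
Proof.
rewrite /lin mulr_sumr -big_split; apply: eq_bigr => t _ /=; ring.
Qed.

Lemma lin_mulr phi c p : lin (fun w => phi w * c) p = lin phi p * c.
Proof. by rewrite /lin mulr_suml; apply: eq_bigr => t _; rewrite mulrA. Qed.

Lemma lin_sum (T : Type) (s : seq T) (f : T -> seq 'I_n -> K) p :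
  lin (fun w => \sum_(i <- s) f i w) p = \sum_(i <- s) lin (f i) p.
Proof.
elim: s => [|i s IH].
  rewrite big_nil /lin big1 // => t _; by rewrite big_nil mulr0.
rewrite big_cons -IH -[lin (f i) p]mul1r -lin_linear.
by apply: eq_lin => w; rewrite big_cons mul1r.
Qed.

Lemma lin_gen_term phi c u r v :
  lin phi (gen_term (c, u, r, v)) = c * lin phi (mulw u v r).
Proof.
rewrite /gen_term !lin_ncmul /lin big_seq1 big_map /=; congr (_ * _).
by apply: eq_bigr => t _; rewrite big_seq1 mul1r /= catA.
Qed.

Lemma nccoefE p w : nccoef p w = lin (fun u => (u == w)%:R) p.
Proof.
rewrite /nccoef /lin big_mkcond; apply: eq_bigr => t _.
by case: eqP; rewrite ?mulr1 ?mulr0.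
Qed.

Lemma lin_supp phi p s : uniq s -> (forall t, t \in p -> t.2 \in s) ->
  lin phi p = \sum_(w <- s) nccoef p w * phi w.
Proof.
move=> us sub; rewrite /nccoef.
under eq_bigr do rewrite mulr_suml big_mkcond.
rewrite exchange_big /lin big_seq [RHS]big_seq.
apply: eq_bigr => t tp /=.
rewrite -big_mkcond /= (big_rem t.2) ?sub //= eqxx big_seq_cond big1 ?addr0 //.
by move=> w /andP[]; rewrite mem_rem_uniq // inE eq_sym => /andP[/negPf->].
Qed.

(** The list [p] may contain words of other degrees whose coefficients cancel, so the sum is first
    regrouped by words. *)
Lemma lin_homog deg e p phi psi : homog deg e p ->
  (forall w, wdeg deg w = e -> phi w = psi w) -> lin phi p = lin psi p.
Proof.
move=> hp h; pose s := undup [seq t.2 | t <- p].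
have sub t : t \in p -> t.2 \in s by move=> tp; rewrite mem_undup map_f.
rewrite !(lin_supp _ (undup_uniq _) sub); apply: eq_bigr => w _.
by have [->|/hp/h->] := eqVneq (nccoef p w) 0; rewrite ?mul0r.
Qed.

Lemma peqP p q : nccoef p =1 nccoef q <-> peq p q.
Proof.
split=> [h phi|h w]; last by rewrite !nccoefE.
pose s := undup [seq t.2 | t <- p ++ q].
have sub t : t \in p ++ q -> t.2 \in s by move=> tp; rewrite mem_undup map_f.
rewrite !(@lin_supp _ _ s (undup_uniq _)).
- by apply: eq_bigr => w _; rewrite h.
- by move=> t tp; apply: sub; rewrite mem_cat tp orbT.
- by move=> t tp; apply: sub; rewrite mem_cat tp.
Qed.

Lemma peq_sym p q : peq p q -> peq q p.
Proof. by move=> h phi; rewrite h. Qed.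

Record subspace (P : ncpoly K n -> Prop) : Prop := Subspace {
  sub_peq : forall p q, peq p q -> P p -> P q;
  sub_nil : P [::];
  sub_cat : forall p q, P p -> P q -> P (p ++ q);
  sub_scale : forall c p, P p -> P (ncscale c p) }.

Lemma sub_comb (P : ncpoly K n -> Prop) T (s : seq T) c f : subspace P ->
  (forall i, P (f i)) -> P (comb s c f).
Proof.
move=> sP h; elim: s => [|i s IH]; first exact: sub_nil.
by apply: (sub_cat sP) IH; apply: sub_scale.
Qed.

Lemma sub_combP (P : ncpoly K n -> Prop) (T : eqType) (s : seq T) c f :
  subspace P -> (forall i, i \in s -> P (f i)) -> P (comb s c f).
Proof.
move=> sP; elim: s => [|i s IH] h; first exact: sub_nil.
apply: (sub_cat sP); first by apply: sub_scale => //; apply: h; rewrite mem_head.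
by apply: IH => j js; apply: h; rewrite inE js orbT.
Qed.

Lemma sub_sub (P : ncpoly K n -> Prop) p q : subspace P -> P p -> P q -> P (ncsub p q).
Proof. by move=> sP hp hq; apply: sub_cat => //; apply: sub_scale. Qed.

Section Ideal.
Variable R : seq (ncpoly K n).

Lemma ideal_subspace : subspace (in_ideal R).
Proof.
split.
- move=> p q /peqP e [ts [h1 h2]]; exists ts; split=> // w; by rewrite -e.
- by exists [::]; split.
- move=> p q [ts [h1 h2]] [ts' [h1' h2']]; exists (ts ++ ts'); split.
    by move=> t; rewrite mem_cat => /orP[/h1|/h1'].
  move=> w; rewrite map_cat flatten_cat !nccoefE !lin_cat.
  by rewrite -!nccoefE h2 h2'.
- move=> c p [ts [h1 h2]].
  exists [seq (c * t.1.1.1, t.1.1.2, t.1.2, t.2) | t <- ts]; split.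
    by move=> t /mapP[t' /h1 ht ->].
  move=> w; rewrite nccoefE lin_scale -nccoefE h2 {h1 h2} nccoefE.
  rewrite nccoefE; elim: ts => [|[[[c' u] r] v] ts IH] /=; first by rewrite lin_nil mulr0.
  by rewrite !lin_cat !lin_gen_term mulrDr IH mulrA.
Qed.

Lemma ideal_ind (P : ncpoly K n -> Prop) : subspace P ->
  (forall r u v, r \in R -> P (mulw u v r)) -> forall p, in_ideal R p -> P p.
Proof.
move=> sP h p [ts [h1 /peqP h2]]; apply: (sub_peq sP (peq_sym h2)).
move: h1; elim: ts {h2} => [|[[[c u] r] v] ts IH] h1 /=; first exact: sub_nil.
apply: (sub_cat sP); last by apply: IH => t tts; apply: h1; rewrite inE tts orbT.
have /= rR := h1 _ (mem_head _ _).
apply: (sub_peq sP (p := ncscale c (mulw u v r))); last by apply: sub_scale => //; apply: h.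
by move=> phi; rewrite lin_gen_term lin_scale.
Qed.

Lemma ideal_gen r u v : r \in R -> in_ideal R (mulw u v r).
Proof.
move=> rR; exists [:: (1, u, r, v)]; split=> [t|].
  by rewrite inE => /eqP->.
apply/peqP => phi; rewrite -[flatten _]/(gen_term (1, u, r, v) ++ [::]) cats0.
by rewrite lin_gen_term mul1r.
Qed.

Lemma ideal_mulw u v p : in_ideal R p -> in_ideal R (mulw u v p).
Proof.
move: p; apply: ideal_ind; last first.
  move=> r u' v' rR; rewrite /mulw -map_comp.
  rewrite (eq_map (g := fun t => (t.1, (u ++ u') ++ t.2 ++ (v' ++ v)))).
    exact: ideal_gen.
  by move=> t /=; rewrite !catA.
have sI := ideal_subspace.
split=> [p q e|||]; first by apply: (sub_peq sI) => phi; rewrite !lin_mulw.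
- exact: sub_nil.
- by move=> p q hp hq; rewrite /mulw map_cat; apply: sub_cat.
- move=> c p hp; apply: (sub_peq sI) (sub_scale sI c hp) => phi.
  by rewrite !(lin_scale, lin_mulw).
Qed.

(** A certificate for non-membership: it later bounds the dimensions of the counterexample from
    below without a rewriting system. *)
Lemma ideal_lin phi p : (forall r u v, r \in R -> lin phi (mulw u v r) = 0) ->
  in_ideal R p -> lin phi p = 0.
Proof.
move=> h; move: p; apply: ideal_ind => //; split.
- by move=> p q ->.
- exact: lin_nil.
- by move=> p q; rewrite lin_cat => -> ->; rewrite addr0.
- by move=> c p; rewrite lin_scale => ->; rewrite mulr0.
Qed.

End Ideal.

Definition hcomp deg d p : ncpoly K n := [seq t <- p | wdeg deg t.2 == d].

Lemma lin_hcomp deg d p phi :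
  lin phi (hcomp deg d p) = lin (fun w => if wdeg deg w == d then phi w else 0) p.
Proof.
rewrite /lin /hcomp big_filter big_mkcond; apply: eq_bigr => t _.
by case: eqP; rewrite ?mulr0.
Qed.

Lemma hcomp_homog deg d p : homog deg d (hcomp deg d p).
Proof.
move=> w; rewrite nccoefE lin_hcomp.
have [//|/eqP nd] := eqVneq (wdeg deg w) d.
rewrite /lin big1 ?eqxx // => t _.
case: ifP => [/eqP h|_]; last by rewrite mulr0.
by case: eqP => [h2|_]; rewrite ?mulr0 //; case: nd; rewrite -h2.
Qed.

Lemma nccoef_hcomp deg d p w :
  nccoef (hcomp deg d p) w = if wdeg deg w == d then nccoef p w else 0.
Proof.
rewrite nccoefE lin_hcomp; case: ifP => [h|/negP h].
  rewrite nccoefE; apply: eq_lin => u; case: (u =P w) => [->|]; first by rewrite h.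
  by case: ifP.
rewrite /lin big1 // => t _; case: (t.2 =P w) => [->|]; last by case: ifP; rewrite mulr0.
by case: ifP => // _; rewrite mulr0.
Qed.

Lemma wdeg_cat (deg : 'I_n -> nat) u v : wdeg deg (u ++ v) = (wdeg deg u + wdeg deg v)%N.
Proof. by rewrite /wdeg big_cat. Qed.

Lemma wdeg_cons (deg : 'I_n -> nat) x v : wdeg deg (x :: v) = (deg x + wdeg deg v)%N.
Proof. by rewrite /wdeg big_cons. Qed.

Lemma hcomp_peq deg d p q : peq p q -> peq (hcomp deg d p) (hcomp deg d q).
Proof. by move=> h phi; rewrite !lin_hcomp h. Qed.

Lemma hcomp_id deg d p : homog deg d p -> peq (hcomp deg d p) p.
Proof.
by move=> h phi; rewrite lin_hcomp; apply: (lin_homog h) => w ->; rewrite eqxx.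
Qed.

(** Each multiple [u r v] is homogeneous, so its component of degree [d] is itself or zero. *)
Lemma ideal_hcomp deg R d p : graded_pres deg R -> in_ideal R p ->
  in_ideal R (hcomp deg d p).
Proof.
case=> _ hR; have sI := ideal_subspace R; move: p; apply: ideal_ind.
  split=> [p q e|||]; first by apply: (sub_peq sI) => phi; rewrite !lin_hcomp e.
  - exact: sub_nil.
  - by move=> p q hp hq; rewrite /hcomp filter_cat; apply: sub_cat.
  - move=> c p hp; apply: (sub_peq sI) (sub_scale sI c hp) => phi.
    by rewrite !(lin_scale, lin_hcomp).
move=> r u v rR; have [e [_ he]] := hR r rR.
have [hd|hd] := eqVneq (wdeg deg u + (e + wdeg deg v))%N d.
  apply: (sub_peq sI) (ideal_gen u v rR) => phi.
  rewrite lin_hcomp !lin_mulw; apply: (lin_homog he) => w we.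
  by rewrite !wdeg_cat we hd eqxx.
apply: (sub_peq sI) (sub_nil sI) => phi.
rewrite lin_hcomp lin_mulw lin_nil.
transitivity (lin (fun _ => 0) r).
  by rewrite /lin big1 // => t _; rewrite mulr0.
by apply: (lin_homog he) => w we; rewrite !wdeg_cat we (negPf hd).
Qed.

End Polynomials.

(** * Normal words *)

Lemma lexle_refl s : lexle s s.
Proof. by elim: s => //= x s ->; rewrite eqxx orbT. Qed.

Lemma lexle_trans t s u : lexle s t -> lexle t u -> lexle s u.
Proof.
elim: t s u => [|y t IH] [|x s] [|z u] //= /orP[h1|/andP[/eqP h1 h1']] /orP[h2|/andP[/eqP h2 h2']].
- by rewrite (ltn_trans h1 h2).
- by rewrite -h2 h1.
- by rewrite h1 h2.
- by rewrite h1 h2 eqxx (IH _ _ h1' h2') orbT.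
Qed.

Lemma lexle_anti s t : lexle s t -> lexle t s -> s = t.
Proof.
elim: s t => [|x s IH] [|y t] //= /orP[h1|/andP[/eqP h1 h1']] /orP[h2|/andP[/eqP h2 h2']].
- by have := ltn_trans h1 h2; rewrite ltnn.
- by move: h1; rewrite h2 ltnn.
- by move: h2; rewrite h1 ltnn.
- by rewrite h1 (IH _ h1' h2').
Qed.

Lemma lexle_total s t : lexle s t || lexle t s.
Proof.
elim: s t => [|x s IH] [|y t] //=.
by case: (ltngtP x y) => //= _; rewrite ?orbT // orbC; apply: IH.
Qed.

Lemma max_exists (T : eqType) (le : rel T) (s : seq T) :
  reflexive le -> transitive le -> total le -> s != [::] ->
  exists2 x, x \in s & forall y, y \in s -> le y x.
Proof.
move=> re tr to; elim: s => // a s IH _.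
have [->|/IH[x xs h]] := eqVneq s [::].
  by exists a; rewrite ?mem_head // => y; rewrite inE => /eqP->.
case/orP: (to a x) => ax.
  exists x; first by rewrite inE xs orbT.
  by move=> y; rewrite inE => /orP[/eqP->|/h].
exists a; first by rewrite mem_head.
by move=> y; rewrite inE => /orP[/eqP->//|/h yx]; apply: tr yx ax.
Qed.

Section Words.
Variables (m : nat) (e : 'I_m -> nat).
Hypothesis e_gt0 : forall x, (0 < e x)%N.

(** The degree [d - e x] is not structurally smaller, hence the fuel; [d.+1] suffices because
    letters have positive degree. Letters are tried in the order of [enum], which makes the lists
    lexicographically sorted. *)
Fixpoint words_fuel (k d : nat) : seq (seq 'I_m) :=
  if k is k'.+1 then
    if d == 0%N then [:: [::]] else
    [seq x :: w | x <- [seq x <- enum 'I_m | (e x <= d)%N], w <- words_fuel k' (d - e x)%N]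
  else [::].

Definition words d := words_fuel d.+1 d.

Lemma words_fuel_eq k k' d : (d < k)%N -> (d < k')%N -> words_fuel k d = words_fuel k' d.
Proof.
elim: k k' d => // k IH [//|k'] d dk dk' /=; case: eqP => // /eqP d0.
congr flatten; apply/eq_in_map => x; rewrite mem_filter => /andP[xd _].
congr map; have := e_gt0 x => ex; apply: IH; lia.
Qed.

Lemma words0 : words 0 = [:: [::]].
Proof. by []. Qed.

Lemma words_rec d : (0 < d)%N ->
  words d = [seq x :: w | x <- [seq x <- enum 'I_m | (e x <= d)%N], w <- words (d - e x)%N].
Proof.
case: d => // d _; transitivity
  [seq x :: w | x <- [seq x <- enum 'I_m | (e x <= d.+1)%N], w <- words_fuel d.+1 (d.+1 - e x)%N].
  by [].
congr flatten; apply/eq_in_map => x; rewrite mem_filter => /andP[xd _].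
by congr map; have := e_gt0 x => ex; apply: words_fuel_eq; lia.
Qed.

Lemma mem_words d w : (w \in words d) = (wdeg e w == d).
Proof.
elim: w d => [|x w IH] [|d].
- by rewrite words0 /wdeg big_nil.
- transitivity false; last by rewrite /wdeg big_nil.
  rewrite words_rec //; apply/negbTE/negP.
  by case/allpairsPdep => x [w []].
- by rewrite words0 wdeg_cons; apply/esym/negbTE; have := e_gt0 x; lia.
- rewrite words_rec // wdeg_cons; apply/allpairsPdep/eqP => [[y [v]]|h].
    rewrite mem_filter => -[/andP[yd _]]; rewrite -[v \in _]/(v \in words _) => hv [? ?]; subst.
    by move: hv; rewrite IH => /eqP; lia.
  exists x, w; split=> //; first by rewrite mem_filter mem_enum andbT; lia.
  by rewrite IH; lia.
Qed.

Lemma uniq_words d : uniq (words d).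
Proof.
elim/ltn_ind: d => [[|d] IH]; first by [].
rewrite words_rec // allpairs_uniq_dep //.
- exact/filter_uniq/enum_uniq.
- by move=> x; rewrite mem_filter => /andP[xd _]; apply: IH; have := e_gt0 x; lia.
- by move=> [x v] [y w] /= _ _ [-> ->].
Qed.

End Words.

(** * Normal words modulo a graded ideal [J], later the ideal of relations or its preimage under a
    substitution *)

Section Normal.
Variables (K : fieldType) (m : nat) (e rk : 'I_m -> nat) (J : ncpoly K m -> Prop).
Hypothesis e_gt0 : forall x, (0 < e x)%N.
Hypothesis rk_inj : injective rk.
Hypothesis sJ : subspace J.
Hypothesis J_mulw : forall u v p, J p -> J (mulw u v p).
Hypothesis J_hcomp : forall d p, J p -> J (hcomp e d p).

(** [J] is stable under homogeneous components, so only words of equal degree have to be compared,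
    and there [deglex_le] is this order. *)
Definition wle (u w : seq 'I_m) := lexle (map rk u) (map rk w).

Definition normal (w : seq 'I_m) := ~ exists q : ncpoly K m,
  J q /\ nccoef q w != 0 /\ forall w', nccoef q w' != 0 -> deglex_le e rk w' w.

Definition normals d := [seq w <- words e d | `[< normal w >]].

Lemma uniq_normals d : uniq (normals d).
Proof. by rewrite filter_uniq // uniq_words. Qed.

Lemma mem_normals d w : (w \in normals d) = `[< normal w >] && (wdeg e w == d).
Proof. by rewrite mem_filter mem_words. Qed.

Lemma wle_refl : reflexive wle. Proof. by move=> w; apply: lexle_refl. Qed.
Lemma wle_trans : transitive wle. Proof. by move=> v u w; apply: lexle_trans. Qed.
Lemma wle_total : total wle. Proof. by move=> u w; apply: lexle_total. Qed.
Lemma wle_anti u w : wle u w -> wle w u -> u = w.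
Proof. by move=> h1 h2; apply: (inj_map rk_inj); apply: lexle_anti. Qed.

Lemma wle_cons x u w : wle (x :: u) (x :: w) = wle u w.
Proof. by rewrite /wle /= ltnn eqxx. Qed.

Definition leading w (q : ncpoly K m) := nccoef q w = 1 /\
  forall u, nccoef q u != 0 -> wdeg e u = wdeg e w /\ wle u w.

Lemma not_normal w : ~ normal w -> exists2 q, J q & leading w q.
Proof.
move=> /contrapT[q [Jq [qw h]]].
exists (ncscale (nccoef q w)^-1 (hcomp e (wdeg e w) q)).
  by apply: sub_scale => //; apply: J_hcomp.
split; first by rewrite nccoefE lin_scale -nccoefE nccoef_hcomp eqxx mulVf.
move=> u; rewrite nccoefE lin_scale -nccoefE nccoef_hcomp.
case: (wdeg e u =P _) => [du|_]; last by rewrite mulr0 eqxx.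
rewrite mulf_eq0 negb_or => /andP[_ /h]; rewrite /deglex_le du ltnn eqxx.
by move=> hl; split.
Qed.

Lemma leading_not_normal w q : J q -> nccoef q w != 0 ->
  (forall u, nccoef q u != 0 -> wdeg e u = wdeg e w /\ wle u w) -> ~ normal w.
Proof.
move=> Jq qw h; apply: contra_notP => _; exists q; split=> //; split=> // u /h[du lu].
by rewrite /deglex_le du ltnn eqxx.
Qed.

(** Left multiplication by [u] preserves the order: if [w] led an element [q] of [J], then [u ++ w]
    would lead [u q]. *)
Lemma normal_suffix u w : normal (u ++ w) -> normal w.
Proof.
move=> nuw; apply: contrapT => /not_normal[q Jq [q1 h]].
apply: (leading_not_normal (J_mulw u [::] Jq)) nuw.
  rewrite nccoefE lin_mulw (eq_lin (psi := fun v => (v == w)%:R)).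
    by rewrite -nccoefE q1 oner_eq0.
  by move=> v; rewrite cats0 eqseq_cat // eqxx.
move=> v; rewrite nccoefE lin_mulw => nz.
have [v' [ev /h[dv lv]]] : exists v', v = u ++ v' /\ nccoef q v' != 0.
  have [|np] := boolP (prefix u v).
    move=> /prefixP[v' ev]; exists v'; split=> //; move: nz.
    rewrite ev nccoefE (eq_lin (psi := fun v => (v == v')%:R)) //.
    by move=> x; rewrite cats0 eqseq_cat // eqxx.
  case/negP: nz; rewrite /lin big1 // => t _; rewrite cats0.
  case: eqP => [h'|_]; last by rewrite mulr0.
  by case/negP: np; rewrite -h' prefix_prefix.
subst v; rewrite !wdeg_cat dv; split=> //.
by elim: u {nz} => //= x u IH; rewrite wle_cons.
Qed.

(** The bound by [w] is carried along because leading words must be controlled when reductions are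
    later moved between degrees. *)
Definition inspan d w p := exists c : seq 'I_m -> K,
  (forall u, c u != 0 -> wle u w) /\
  J (ncsub p (comb (normals d) c (@ncword K m))).

Lemma inspan_subspace d w : subspace (inspan d w).
Proof.
split.
- move=> p q pq [c [hc h]]; exists c; split=> //.
  by apply: (sub_peq sJ) h => phi; rewrite !lin_sub pq.
- exists (fun _ => 0); split; first by move=> u; rewrite eqxx.
  apply: (sub_peq sJ) (sub_nil sJ) => phi; rewrite lin_sub lin_nil lin_comb.
  by rewrite big1 ?subr0 // => i _; rewrite mul0r.
- move=> p q [c [hc h]] [c' [hc' h']]; exists (fun u => c u + c' u); split.
    move=> u hu; have [c0|/hc//] := eqVneq (c u) 0.
    by apply: hc'; move: hu; rewrite c0 add0r.
  apply: (sub_peq sJ) (sub_cat sJ h h') => phi.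
  rewrite !(lin_sub, lin_cat, lin_comb).
  under [in RHS]eq_bigr do rewrite mulrDl.
  rewrite big_split /=; ring.
- move=> a p [c [hc h]]; exists (fun u => a * c u); split.
    by move=> u; rewrite mulf_eq0 negb_or => /andP[_ /hc].
  apply: (sub_peq sJ) (sub_scale sJ a h) => phi.
  rewrite !(lin_sub, lin_scale, lin_comb).
  under [in RHS]eq_bigr do rewrite -mulrA.
  rewrite -mulr_sumr; ring.
Qed.

Lemma inspanW d w w' p : wle w w' -> inspan d w p -> inspan d w' p.
Proof.
by move=> ww' [c [hc h]]; exists c; split=> // u /hc uw; apply: wle_trans ww'.
Qed.

Lemma inspan_J d w p q : J (ncsub p q) -> inspan d w q -> inspan d w p.
Proof.
move=> Jpq [c [hc h]]; exists c; split=> //.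
apply: (sub_peq sJ) (sub_cat sJ Jpq h) => phi.
by rewrite lin_cat !lin_sub; ring.
Qed.

Lemma comb_delta (s : seq (seq 'I_m)) w : uniq s -> w \in s ->
  peq (comb s (fun u => (u == w)%:R) (@ncword K m)) (ncword K w).
Proof.
move=> us ws phi; rewrite lin_comb (big_rem w) //= eqxx mul1r big_seq_cond big1 ?addr0 //.
by move=> u /andP[]; rewrite mem_rem_uniq // inE => /andP[/negPf->]; rewrite mul0r.
Qed.

Lemma words_decomp d p : homog e d p -> peq p (comb (words e d) (nccoef p) (@ncword K m)).
Proof.
move=> hp; apply/peqP => w; rewrite [RHS]nccoefE lin_comb.
have [wd|wd] := boolP (w \in words e d).
  rewrite (big_rem w) //= lin_word eqxx mulr1 big_seq_cond big1 ?addr0 //.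
  move=> u /andP[]; rewrite mem_rem_uniq ?uniq_words // inE lin_word => /andP[/negPf->].
  by rewrite mulr0.
rewrite big_seq_cond big1 => [|u /andP[ud _]].
  by apply/eqP; apply: contraNT wd => /hp wd; rewrite mem_words // wd.
rewrite lin_word; case: eqP => [uw|]; last by rewrite mulr0.
by move: wd; rewrite -uw ud.
Qed.

Lemma nf_exists w : inspan (wdeg e w) w (ncword K w).
Proof.
have [d wd] : exists d, wdeg e w = d by exists (wdeg e w).
rewrite wd.
(* Induction on the number of words of degree [d] below [w]: reduction terminates since each degree
   has finitely many words. *)
have [k] := ubnP (count (fun u => wle u w) (words e d)).
elim: k w wd => // k IH w wd hk.
have [nw|/not_normal[q Jq [q1 h]]] := pselect (normal w).
  exists (fun u => (u == w)%:R); split.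
    by move=> u; case: (u =P w) => [->|]; rewrite ?eqxx // wle_refl.
  apply: (sub_peq sJ) (sub_nil sJ) => phi.
  rewrite lin_sub (comb_delta (uniq_normals d)) ?lin_nil ?subrr //.
  by rewrite mem_normals wd eqxx andbT; apply/asboolP.
(* Modulo [J] the word [w] equals [q'], all of whose words are strictly smaller. *)
pose q' := ncsub (ncword K w) q.
have hq' u : nccoef q' u != 0 -> [/\ wdeg e u = d, wle u w & u != w].
  rewrite nccoefE lin_sub lin_word -nccoefE.
  case: (w =P u) => [<-|/eqP nwu]; first by rewrite q1 mulr1n subrr => /eqP.
  by rewrite sub0r oppr_eq0 => /h[du uw]; split; rewrite -?wd // eq_sym.
have pq' : peq q' (comb (words e d) (nccoef q') (@ncword K m)).
  by apply: words_decomp => u /hq'[].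
apply: (inspan_J (q := q')).
  by apply: (sub_peq sJ) Jq => phi; rewrite !lin_sub; ring.
apply: (sub_peq (inspan_subspace d w) (peq_sym pq')).
elim: (words e d) => [|u s IHs]; first exact: sub_nil (inspan_subspace d w).
apply: (sub_cat (inspan_subspace d w)) IHs.
have [->|/hq'[ud uw nuw]] := eqVneq (nccoef q' u) 0.
  apply: (sub_peq (inspan_subspace d w)) (sub_nil (inspan_subspace d w)) => phi.
  by rewrite lin_scale mul0r lin_nil.
apply: sub_scale; first exact: inspan_subspace.
apply: (inspanW uw); apply: IH => //.
move: hk; rewrite ltnS; apply: leq_trans; rewrite -!size_filter.
have sub : {subset w :: [seq u0 <- words e d | wle u0 u] <= [seq u0 <- words e d | wle u0 w]}.
  move=> v; rewrite inE !mem_filter => /orP[/eqP->|/andP[vu ->]].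
    by rewrite wle_refl mem_words // wd eqxx.
  by rewrite (wle_trans vu uw).
apply: uniq_leq_size sub; rewrite /= filter_uniq ?uniq_words // andbT.
by rewrite mem_filter; apply/andP => -[wu _]; case/eqP: nuw; apply: wle_anti.
Qed.

Lemma span_normals d p : homog e d p ->
  exists c, J (ncsub p (comb (normals d) c (@ncword K m))).
Proof.
move=> hp; have pq := words_decomp hp.
have [w0 hw0] : exists w0, forall u, u \in words e d -> wle u w0.
  have [->|/(max_exists wle_refl wle_trans wle_total)[w _ h]] := eqVneq (words e d) [::].
    by exists [::].
  by exists w.
suff [c [_ h]] : inspan d w0 p by exists c.
apply: (sub_peq (inspan_subspace d w0) (peq_sym pq)).
apply: sub_combP => [|u ud]; first exact: inspan_subspace.
apply: (inspanW (hw0 _ ud)); have := nf_exists u.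
by move: ud; rewrite mem_words // => /eqP->.
Qed.

(** Otherwise the largest word with a nonzero coefficient would lead an element of [J] and yet be
    normal. *)
Lemma normals_free d c : J (comb (normals d) c (@ncword K m)) ->
  forall u, u \in normals d -> c u = 0.
Proof.
move=> Jc u ud; apply/eqP; apply: contraT => cu.
have cf w : nccoef (comb (normals d) c (@ncword K m)) w = if w \in normals d then c w else 0.
  rewrite nccoefE lin_comb; case: ifP => wd.
    rewrite (big_rem w) //= lin_word eqxx mulr1 big_seq_cond big1 ?addr0 //.
    move=> v /andP[]; rewrite mem_rem_uniq ?uniq_normals // inE lin_word => /andP[/negPf->].
    by rewrite mulr0.
  rewrite big_seq_cond big1 // => v /andP[vd _]; rewrite lin_word.
  by case: eqP => [vw|]; rewrite ?mulr0 //; rewrite -vw vd in wd.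
have : [seq w <- normals d | c w != 0] != [::].
  by rewrite -has_filter; apply/hasP; exists u.
case/(max_exists wle_refl wle_trans wle_total) => w; rewrite mem_filter => /andP[cw wd] hmax.
have nw : normal w by move: wd; rewrite mem_normals => /andP[/asboolP].
have [] // := @leading_not_normal w _ Jc _ _; first by rewrite cf wd.
move=> v; rewrite cf; case: ifP => [vd cv|]; last by rewrite eqxx.
split; last by apply: hmax; rewrite mem_filter cv.
by move: vd wd; rewrite !mem_normals => /andP[_ /eqP->] /andP[_ /eqP->].
Qed.

End Normal.

(** * Hilbert functions *)

Section Homogeneous.
Variables (K : fieldType) (n : nat) (deg : 'I_n -> nat).
Implicit Types p q : ncpoly K n.

Lemma homogP d p : homog deg d p <->
  (forall phi, (forall w, wdeg deg w = d -> phi w = 0) -> lin phi p = 0).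
Proof.
split=> [hp phi h|h w].
  rewrite (lin_homog (psi := fun _ => 0) hp h) /lin big1 // => t _.
  by rewrite mulr0.
apply: contraNeq => nd; rewrite nccoefE h // => u ud.
by case: eqP => // uw; case/eqP: nd; rewrite -uw.
Qed.

Lemma homog_ncmul a b p q : homog deg a p -> homog deg b q ->
  homog deg (a + b) (ncmul p q).
Proof.
move=> /homogP hp /homogP hq; apply/homogP => phi h.
rewrite lin_ncmul; apply: hp => u ua; apply: hq => v vb.
by apply: h; rewrite wdeg_cat ua vb.
Qed.

Lemma homog_word w : homog deg (wdeg deg w) (ncword K w).
Proof. by apply/homogP => phi h; rewrite lin_word h. Qed.

End Homogeneous.

Section Dimension.
Variables (K : fieldType) (n : nat) (R : seq (ncpoly K n)).

Lemma ideal_ncmull p q : in_ideal R q -> in_ideal R (ncmul p q).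
Proof.
move=> Iq; apply: (sub_peq (ideal_subspace R)
  (p := comb p (fun t => t.1) (fun t => mulw t.2 [::] q))).
  move=> phi; rewrite lin_comb lin_ncmul; apply: eq_bigr => t _; rewrite lin_mulw.
  by congr (_ * _); apply: eq_lin => w; rewrite cats0.
by apply: sub_comb => [|t]; [exact: ideal_subspace|exact: ideal_mulw].
Qed.

Lemma ideal_ncmulr p q : in_ideal R p -> in_ideal R (ncmul p q).
Proof.
move=> Ip; apply: (sub_peq (ideal_subspace R)
  (p := comb q (fun t => t.1) (fun t => mulw [::] t.2 p))).
  move=> phi; rewrite lin_comb lin_ncmul; under eq_bigr do rewrite lin_mulw /lin mulr_sumr.
  rewrite exchange_big /=; apply: eq_bigr => t _; rewrite /lin mulr_sumr.
  by apply: eq_bigr => s _; ring.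
by apply: sub_comb => [|t]; [exact: ideal_subspace|exact: ideal_mulw].
Qed.

(** If [l < k], the matrix of the [f i] in terms of the [g j] has a nonzero row vector in its left
    kernel, which is a relation among the [f i] modulo the ideal. *)
Lemma span_card k l (f : 'I_k -> ncpoly K n) (g : 'I_l -> ncpoly K n) :
  (forall c, in_ideal R (lincomb c f) -> forall i, c i = 0) ->
  (forall i, exists c, in_ideal R (ncsub (f i) (lincomb c g))) -> (k <= l)%N.
Proof.
move=> fr /choice[C hC]; rewrite leqNgt; apply/negP => lk.
pose M : 'M[K]_(k, l) := \matrix_(i, j) C i j.
have : kermx M != 0.
  by rewrite -mxrank_eq0 mxrank_ker subn_eq0 -ltnNge (leq_ltn_trans (rank_leq_col M)).
case/rowV0Pn => u /sub_kermxP uM nu.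
case/eqP: nu; apply/rowP => i; rewrite mxE; apply: (fr (fun i => u 0 i)) => {i}.
have sI := ideal_subspace R.
apply: (sub_peq sI (p := comb (enum 'I_k) (fun i => u 0 i) (fun i => ncsub (f i) (lincomb (C i) g)))).
  move=> phi; rewrite lin_comb lin_lincomb big_enum /=.
  under eq_bigr do rewrite lin_sub lin_lincomb mulrBr.
  rewrite sumrB [X in _ - X](_ : _ = 0) ?subr0 //.
  under eq_bigr do rewrite mulr_sumr.
  rewrite exchange_big big1 //= => j _.
  under eq_bigr do rewrite mulrA.
  rewrite -mulr_suml; have := congr1 (fun A : 'rV_l => A 0 j) uM.
  rewrite !mxE => h; rewrite (_ : \sum_i _ = 0) ?mul0r // -[RHS]h.
  by apply: eq_bigr => i _; rewrite mxE.
by apply: sub_comb => // i; apply: hC.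
Qed.

Lemma hilb_dim_unique deg d k l : hilb_dim deg R d k -> hilb_dim deg R d l -> k = l.
Proof.
move=> [f [hf [ff sf]]] [g [hg [fg sg]]]; apply/eqP; rewrite eqn_leq.
by rewrite (span_card ff (fun i => sg _ (hf i))) (span_card fg (fun i => sf _ (hg i))).
Qed.

End Dimension.

Lemma sum_nth (T : Type) (V : nmodType) (x0 : T) (s : seq T) (F : T -> V) :
  \sum_(u <- s) F u = \sum_(i < size s) F (nth x0 s i).
Proof. by rewrite (big_nth x0) big_mkord. Qed.

Section Generators.
Variables (K : fieldType) (n : nat) (deg : 'I_n -> nat) (R : seq (ncpoly K n)).
Variables (m : nat) (e : 'I_m -> nat) (s : 'I_m -> ncpoly K n).
Hypothesis hR : graded_pres deg R.
Hypothesis hs : forall k, (0 < e k)%N /\ homog deg (e k) (s k).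

Definition wsubst (w : seq 'I_m) : ncpoly K n :=
  foldr (fun k acc => ncmul (s k) acc) (ncone K n) w.

(** The kernel of the map from the free algebra on the new generators to the algebra; normality in
    [automaton] refers to it. *)
Definition relideal (q : ncpoly K m) : Prop := in_ideal R (subst s q).

Lemma lin_subst phi q : lin phi (subst s q) = lin (fun w => lin phi (wsubst w)) q.
Proof. by rewrite [LHS](lin_comb phi q (fun t => t.1) (fun t => wsubst t.2)). Qed.

Lemma lin_wsubst_cat phi u v :
  lin phi (wsubst (u ++ v)) = lin (fun u' => lin (fun v' => phi (u' ++ v')) (wsubst v)) (wsubst u).
Proof.
elim: u phi => [|x u IH] phi; first by rewrite [RHS]lin_word.
rewrite !lin_ncmul; apply: eq_lin => a; rewrite IH; apply: eq_lin => b.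
by apply: eq_lin => c; rewrite catA.
Qed.

Lemma homog_wsubst w : homog deg (wdeg e w) (wsubst w).
Proof.
elim: w => [|x w IH].
  by have := @homog_word K _ deg [::]; rewrite /wdeg !big_nil.
by rewrite wdeg_cons; apply: homog_ncmul => //; case: (hs x).
Qed.

Lemma subst_ncmul p q : peq (subst s (ncmul p q)) (ncmul (subst s p) (subst s q)).
Proof.
move=> phi; rewrite lin_subst !lin_ncmul lin_subst; apply: eq_lin => u.
transitivity (lin (fun a => \sum_(t <- q) t.1 * lin (fun b => phi (a ++ b)) (wsubst t.2)) (wsubst u)).
  rewrite lin_sum; apply: eq_bigr => t _; rewrite lin_wsubst_cat.
  by rewrite mulrC -lin_mulr; apply: eq_lin => a; rewrite mulrC.
by apply: eq_lin => a; rewrite lin_subst.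
Qed.

Lemma relideal_subspace : subspace relideal.
Proof.
have sI := ideal_subspace R; split.
- by move=> p q pq; apply: (sub_peq sI) => phi; rewrite !lin_subst pq.
- exact: sub_nil sI.
- by move=> p q hp hq; rewrite /relideal /subst map_cat flatten_cat; apply: sub_cat.
- move=> c p hp; apply: (sub_peq sI) (sub_scale sI c hp) => phi.
  by rewrite !(lin_scale, lin_subst).
Qed.

Lemma relideal_mulw u v p : relideal p -> relideal (mulw u v p).
Proof.
move=> hp; apply: (sub_peq relideal_subspace (p := ncmul (ncword K u) (ncmul p (ncword K v)))).
  by move=> phi; rewrite !(lin_ncmul, lin_word, lin_mulw); apply: eq_lin => w; rewrite lin_word.
apply: (sub_peq (ideal_subspace R) (peq_sym (subst_ncmul _ _))); apply: ideal_ncmull.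
by apply: (sub_peq (ideal_subspace R) (peq_sym (subst_ncmul _ _))); apply: ideal_ncmulr.
Qed.

(** Substitution is graded, because [s k] is homogeneous of degree [e k]; so [relideal] inherits
    stability under components. *)
Lemma hcomp_subst d p : peq (hcomp deg d (subst s p)) (subst s (hcomp e d p)).
Proof.
move=> phi; rewrite lin_hcomp !lin_subst lin_hcomp; apply: eq_lin => w.
case: ifP => [/eqP wd|/negP wd].
  apply: (lin_homog (@homog_wsubst w)) => v ->; by rewrite wd eqxx.
have /homogP := @homog_wsubst w; apply=> v vd.
by case: eqP => // h; case: wd; rewrite -vd h.
Qed.

Lemma relideal_hcomp d p : relideal p -> relideal (hcomp e d p).
Proof.
move=> hp; apply: (sub_peq (ideal_subspace R) (hcomp_subst d p)).
exact: ideal_hcomp.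
Qed.

Section Basis.
Variable rk : 'I_m -> nat.
Hypothesis rk_inj : injective rk.
Hypothesis gens : forall i, exists q, in_ideal R (ncsub (subst s q) (ncword K [:: i])).

Lemma gens_poly g : exists q, in_ideal R (ncsub g (subst s q)).
Proof.
have sI := ideal_subspace R.
have sP : subspace (fun g => exists q, in_ideal R (ncsub g (subst s q))).
  split.
  - move=> p q pq [r hr]; exists r.
    by apply: (sub_peq sI) hr => phi; rewrite !lin_sub pq.
  - exists [::]; exact: sub_nil.
  - move=> p q [r hr] [r' hr']; exists (r ++ r').
    apply: (sub_peq sI) (sub_cat sI hr hr') => phi.
    by rewrite !(lin_cat, lin_sub, lin_subst); ring.
  - move=> c p [r hr]; exists (ncscale c r).
    apply: (sub_peq sI) (sub_scale sI c hr) => phi.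
    by rewrite !(lin_scale, lin_sub, lin_subst); ring.
apply: (sub_peq sP (p := comb g (fun t => t.1) (fun t => ncword K t.2))).
  by move=> phi; rewrite lin_comb; apply: eq_bigr => t _; rewrite lin_word.
apply: (@sub_comb _ _ _ _ _ _ _ sP) => t; elim: t.2 => [|x w [q hq]] {t}.
  exists (ncword K [::]); apply: (sub_peq sI) (sub_nil sI) => phi.
  by rewrite lin_sub lin_subst !lin_word lin_nil subrr.
have [r hr] := gens x; exists (ncmul r q).
have h1 := ideal_ncmulr (ncword K w) hr; have h2 := ideal_ncmull (subst s r) hq.
apply: (sub_peq sI) (sub_sub sI h2 h1) => phi.
have E : lin (fun u => lin (fun v => phi (u ++ v)) (ncsub (ncword K w) (subst s q))) (subst s r) =
  lin (fun u => phi (u ++ w)) (subst s r) -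
  lin (fun u => lin (fun v => phi (u ++ v)) (subst s q)) (subst s r).
  rewrite -[RHS]addrC -mulN1r -lin_linear; apply: eq_lin => u.
  by rewrite lin_sub lin_word addrC mulN1r.
have E2 p : lin (fun u => lin (fun v => phi (u ++ v)) (ncword K w)) p = lin (fun u => phi (u ++ w)) p.
  by apply: eq_lin => u; rewrite lin_word.
rewrite !lin_sub !lin_ncmul E lin_sub subst_ncmul lin_ncmul !E2 !lin_word cat1s.
by ring.
Qed.

Lemma hilb_dim_normals d : hilb_dim deg R d (size (normals e rk relideal d)).
Proof.
have e0 x : (0 < e x)%N by case: (hs x).
set N := normals _ _ _ _.
have uN : uniq N by apply: uniq_normals.
have sI := ideal_subspace R.
exists (fun i => wsubst (nth [::] N i)); split; [|split].
- move=> i; have : nth [::] N i \in N by rewrite mem_nth.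
  by rewrite mem_normals // => /andP[_ /eqP<-]; apply: homog_wsubst.
- move=> c hc.
  (* Coefficients given by position are reread as a function of words, with 0 as default off [N]. *)
  pose c' u := if insub (index u N) is Some i then c i else 0.
  have c'E (i : 'I_(size N)) : c' (nth [::] N i) = c i.
    by rewrite /c' index_uniq // valK.
  have h : relideal (comb N c' (@ncword K m)).
    apply: (sub_peq sI) hc => phi; rewrite lin_lincomb lin_subst lin_comb (sum_nth [::]).
    by apply: eq_bigr => i _; rewrite lin_word c'E.
  have fr := normals_free e0 h.
  by move=> i; rewrite -c'E; apply: fr; rewrite mem_nth.
- move=> g hg; have [q hq] := gens_poly g.
  have {}hq := ideal_hcomp d hR hq.
  have [c hc] := span_normals e0 rk_inj relideal_subspace relideal_hcomp (hcomp_homog (deg := e) (d := d) (p := q)).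
  exists (fun i => c (nth [::] N i)).
  apply: (sub_peq sI) (sub_cat sI hq hc) => phi.
  have hg' := hcomp_id hg phi; rewrite lin_hcomp in hg'.
  rewrite [RHS]lin_sub [in RHS]lin_lincomb lin_cat lin_hcomp !(lin_sub, lin_subst).
  rewrite hg' lin_comb lin_hcomp (sum_nth [::]).
  under eq_bigr do rewrite lin_word.
  suff -> : lin (fun w => lin (fun w0 => if wdeg deg w0 == d then phi w0 else 0) (wsubst w)) q =
    lin (fun w => if wdeg e w == d then lin phi (wsubst w) else 0) q by ring.
  by have := hcomp_subst d q phi; rewrite lin_hcomp !lin_subst lin_hcomp.
Qed.

End Basis.
End Generators.

Section Letters.
Variables (K : fieldType) (n : nat) (deg : 'I_n -> nat) (R : seq (ncpoly K n)).
Hypothesis hR : graded_pres deg R.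

Definition letter_poly (i : 'I_n) := ncword K [:: i].

Lemma letter_poly_homog i : (0 < deg i)%N /\ homog deg (deg i) (letter_poly i).
Proof.
split; first by case: hR.
by have := @homog_word K n deg [:: i]; rewrite wdeg_cons /wdeg big_nil addn0.
Qed.

Lemma subst_letter_poly q : peq (subst letter_poly q) q.
Proof.
move=> phi; rewrite lin_subst; apply: eq_lin => w.
elim: w phi => [|x w IH] phi; first by rewrite lin_word.
by rewrite lin_ncmul lin_word IH.
Qed.

Lemma letter_poly_gens i :
  exists q, in_ideal R (ncsub (subst letter_poly q) (ncword K [:: i])).
Proof.
exists (ncword K [:: i]); apply: (sub_peq (ideal_subspace R)) (sub_nil (ideal_subspace R)).
by move=> phi; rewrite lin_nil lin_sub subst_letter_poly subrr.
Qed.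

Lemma relideal_letter_poly : relideal R letter_poly = in_ideal R.
Proof.
apply: funext => q; apply: propext; split; apply: (sub_peq (ideal_subspace R)).
  exact: subst_letter_poly.
exact/peq_sym/subst_letter_poly.
Qed.

(** The case where the new generators are the letters themselves; it also shows that every graded
    presentation has a Hilbert function. *)
Lemma hilb_dim_letters d :
  hilb_dim deg R d (size (normals deg (@nat_of_ord n) (in_ideal R) d)).
Proof.
rewrite -[X in normals _ _ X]relideal_letter_poly.
exact: (hilb_dim_normals hR letter_poly_homog (@ord_inj n) letter_poly_gens d).
Qed.

End Letters.

(** * Automaton algebras of linear growth *)

(** Two of the first [#|T| + 1] values coincide by pigeonhole, and determinism propagates the
    coincidence. *)
Lemma eventually_periodic (T : finType) (S : nat -> T) :
  (forall d d', S d = S d' -> S d.+1 = S d'.+1) ->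
  exists N P, (0 < P)%N /\ forall d, (N <= d)%N -> S (d + P)%N = S d.
Proof.
move=> hS; pose f (i : 'I_#|T|.+1) := S i.
have : ~~ injectiveb f.
  by apply/negP => /injectiveP/leq_card; rewrite card_ord ltnn.
case/injectivePn => i [j nij fij].
have {nij fij} [a [b [ab Sab]]] : exists a b, (a < b)%N /\ S a = S b.
  have [ij|ji|/val_inj ij] := ltngtP i j.
  - by exists i, j.
  - by exists j, i.
  - by rewrite ij eqxx in nij.
exists a, (b - a)%N; split=> [|d ad]; first by rewrite subn_gt0.
rewrite -(subnKC ad); elim: (d - a)%N => [|k IH].
  by rewrite addn0 subnKC // ltnW.
by rewrite addnS; apply: hS.
Qed.

Lemma periodic_rational h N P : (0 < P)%N ->
  (forall d, (N <= d)%N -> h (d + P)%N = h d) -> rational_series h.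
Proof.
(* The product of [1 - z^P] with the series is a polynomial: its coefficients [h k - h (k - P)]
   vanish from degree [N + P] on. *)
move=> P0 hP; pose Q : {poly rat} := 1 - 'X^P.
pose S k : rat := \sum_(i < k.+1) Q`_i * ((h (k - i)%N)%:R).
have sel k j (F : nat -> rat) : (j <= k)%N ->
    \sum_(i < k.+1) (val i == j)%:R * F i = F j.
  move=> jk; rewrite (bigD1 (Ordinal (jk : (j < k.+1)%N))) //= eqxx mul1r big1 ?addr0 //.
  by move=> i; rewrite -val_eqE /= => /negPf->; rewrite mul0r.
exists (\poly_(k < N + P) S k), Q; split.
  apply/eqP => /(congr1 (fun q : {poly rat} => q`_0)).
  by rewrite coefB coef1 coefXn coef0 (ltn_eqF P0) subr0 => /eqP; rewrite oner_eq0.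
move=> k; rewrite coef_poly; case: ltnP => // hk.
transitivity (\sum_(i < k.+1) (val i == 0%N)%:R * (h (k - i)%N)%:R
   - \sum_(i < k.+1) (val i == P)%:R * (h (k - i)%N)%:R : rat).
  by rewrite -sumrB; apply: eq_bigr => i _; rewrite coefB coef1 coefXn mulrBl.
rewrite (sel k 0%N (fun i => (h (k - i)%N)%:R)) // (sel k P (fun i => (h (k - i)%N)%:R)); last by lia.
have := hP (k - P)%N; rewrite subnK; last by lia.
by rewrite subn0 => ->; [rewrite subrr|lia].
Qed.

Section CountAccepted.
Variables (m : nat) (e : 'I_m -> nat) (Q : finType) (delta : Q -> 'I_m -> Q) (F : pred Q).
Hypothesis e_gt0 : forall x, (0 < e x)%N.

Definition accepted d q := count (fun w => F (foldl delta q w)) (words e d).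

Lemma accepted_rec d q : (0 < d)%N ->
  accepted d q = (\sum_(x : 'I_m | (e x <= d)%N) accepted (d - e x) (delta q x))%N.
Proof.
move=> d0; rewrite /accepted words_rec // count_flatten sumnE !big_map big_filter big_enum_cond /=.
by apply: eq_bigr => x _; rewrite count_map.
Qed.

(* Windows of 1 + max e consecutive counts determine the next window, and range over
   a finite set. *)
Lemma accepted_periodic C (q0 : Q) :
  (forall d u, (accepted d (foldl delta q0 u) <= C)%N) ->
  exists N P, (0 < P)%N /\
    forall d, (N <= d)%N -> accepted (d + P) q0 = accepted d q0.
Proof.
move=> bnd; pose D := (\max_x e x).+1.
have eD x : (e x < D)%N by rewrite ltnS; apply: leq_bigmax.
(* Counts are bounded only from reachable states; the others are recorded as 0, so that windows lie
   in a finite type. *)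
pose reach q := `[< exists u, q = foldl delta q0 u >].
have reach0 : reach q0 by apply/asboolP; exists [::].
have reachS q x : reach q -> reach (delta q x).
  by move=> /asboolP[u ->]; apply/asboolP; exists (rcons u x); rewrite -cats1 foldl_cat.
have bndR d q : reach q -> (accepted d q < C.+1)%N.
  by move=> /asboolP[u ->]; apply: bnd.
pose S d : {ffun 'I_D * Q -> 'I_C.+1} :=
  [ffun a : 'I_D * Q => inord (if reach a.2 then accepted (d + a.1) a.2 else 0)].
have SE d d' : S d = S d' <-> forall i q, (i < D)%N -> reach q ->
    accepted (d + i) q = accepted (d' + i) q.
  split=> [eqS i q iD rq|h].
    have := congr1 (fun f : {ffun 'I_D * Q -> 'I_C.+1} => nat_of_ord (f (Ordinal iD, q))) eqS.
    by rewrite !ffunE /= rq !inordK // bndR.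
  apply/ffunP => -[i q]; rewrite !ffunE /=; case: ifP => // rq.
  by rewrite h.
have step d d' : S d = S d' -> S d.+1 = S d'.+1.
  move=> /SE h; apply/SE => i q iD rq; rewrite !addSn -!addnS.
  have [iD'|] := ltnP i.+1 D; first exact: h.
  (* Only the entry in degree [d + D] is new, and the recurrence expresses it by the degrees
     [d + D - e x], inside the old window since [0 < e x < D]. *)
  move=> Di; have -> : i.+1 = D by lia.
  rewrite !accepted_rec; try by rewrite /D; lia.
  apply: congr_big => // [x|x _]; have := eD x; first by move=> ?; lia.
  by move=> ex; rewrite -!addnBA 1?ltnW //; apply: h; [have := e_gt0 x; lia|apply: reachS].
have [N [P [P0 hP]]] := eventually_periodic step.
exists N, P; split=> // d /hP/SE h.
by have := h 0%N q0 isT reach0; rewrite !addn0.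
Qed.

End CountAccepted.

Lemma automaton_rational (K : fieldType) n (deg : 'I_n -> nat) (R : seq (ncpoly K n)) :
  graded_pres deg R -> linear_growth deg R -> automaton deg R -> rational_hilb deg R.
Proof.
move=> hR [h [hh [C hC]]] [m [e [s [rk [rk_inj [hs [gens [Q [q0 [delta [F hL]]]]]]]]]]].
exists h; split=> //.
have e0 x : (0 < e x)%N by case: (hs x).
have hN d : h d = size (normals e rk (relideal R s) d).
  exact: hilb_dim_unique (hh d) (hilb_dim_normals hR hs rk_inj gens d).
have hL' w : normal e rk (relideal R s) w <-> F (foldl delta q0 w) by exact: hL.
have hacc d : h d = accepted e delta F d q0.
  rewrite hN size_filter; apply: eq_count => w.
  by apply/asboolP/idP => /hL'.
(* A word accepted after reading [u] is a suffix of a normal word, hence normal; so linear growth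
   bounds the counts from all reachable states. *)
have [d u|N [P [P0 hP]]] := @accepted_periodic _ e _ delta F e0 C q0.
  apply: leq_trans (hC d); rewrite hN /accepted -size_filter.
  apply: uniq_leq_size => [|w]; first by rewrite filter_uniq ?uniq_words.
  rewrite mem_filter mem_normals // mem_words // => /andP[Fw ->]; rewrite andbT.
  apply/asboolP; apply: (@normal_suffix _ _ e rk (relideal R s)) (u) _ _.
  - exact: relideal_subspace.
  - exact: relideal_mulw.
  - by move=> *; apply: relideal_hcomp hR hs _ _ _.
  - by apply/hL'; rewrite foldl_cat.
by apply: (periodic_rational P0 (N := N)) => d Nd; rewrite !hacc hP.
Qed.

(** * Transfer of normal forms between degrees *)

Section LeftStable.
Variables (m : nat) (T : finType) (st : seq 'I_m -> T) (L : seq 'I_m -> Prop).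
Hypothesis st_step : forall x w w', st w = st w' -> st (x :: w) = st (x :: w').
Hypothesis st_L : forall w w', st w = st w' -> L w -> L w'.

(* The states of the automaton are the transformations of T induced by words:
   [st] reads words from right to left, an automaton from left to right. *)
Lemma regular_left_stable : regular_lang L.
Proof.
(* By [st_step] the choice of [w] does not matter; elements of [T] that are not of the form [st w]
   are left fixed. *)
pose step x q : T :=
  if pselect (exists w, st w = q) is left h then st (x :: projT1 (cid h)) else q.
have stepE x w : step x (st w) = st (x :: w).
  rewrite /step; case: pselect => [h|[]]; last by exists w.
  by case: cid => w' /= /(@st_step x).
pose delta (f : {ffun T -> T}) x : {ffun T -> T} := [ffun q => f (step x q)].
have deltaE w f q : foldl delta f w q = f (foldr step q w).
  by elim: w f => //= x w IH f; rewrite IH ffunE.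
have stE w : foldr step (st [::]) w = st w by elim: w => //= x w ->.
exists {ffun T -> T}, [ffun q => q], delta,
  (fun f : {ffun T -> T} => `[< exists2 w, st w = f (st [::]) & L w >]) => w.
rewrite deltaE ffunE stE; split=> [Lw|/asboolP[w' /st_L]]; last exact.
by apply/asboolP; exists w.
Qed.

End LeftStable.

Section SortedWords.
Variables (m : nat) (e : 'I_m -> nat).
Hypothesis e_gt0 : forall x, (0 < e x)%N.
Notation le := (wle (@nat_of_ord m)).

(** First letters increase along the list and tails are sorted by induction. Through this, the order
    of candidate words becomes the order of their positions. *)
Lemma sorted_words d : sorted le (words e d).
Proof.
rewrite sorted_pairwise; last exact: wle_trans.
elim/ltn_ind: d => [[|d] IH]; first by [].
rewrite words_rec //.
have : pairwise (fun x y : 'I_m => (x < y)%N) [seq x <- enum 'I_m | (e x <= d.+1)%N].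
  apply: subseq_pairwise (filter_subseq _ _) _.
  rewrite -(pairwise_map (@nat_of_ord m) ltn) val_enum_ord -sorted_pairwise; last exact: ltn_trans.
  exact: iota_ltn_sorted.
have : all (fun x => (e x <= d.+1)%N) [seq x <- enum 'I_m | (e x <= d.+1)%N].
  exact: filter_all.
elim: [seq x <- enum 'I_m | _] => //= x s IHs /andP[xd sd] /andP[xs ss].
rewrite pairwise_cat IHs // andbT; apply/andP; split.
  apply/allrelP => u v /mapP[u' _ ->] /allpairsPdep[y [v' [ys _ ->]]].
  by rewrite /wle /=; move/allP: xs => /(_ _ ys)->.
rewrite pairwise_map; have : pairwise le (words e (d.+1 - e x)).
  by apply: IH; have := e_gt0 x; lia.
by apply: sub_pairwise => u v; rewrite /= wle_cons.
Qed.

End SortedWords.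

Section NormalForms.
Variables (K : fieldType) (n : nat) (deg : 'I_n -> nat) (R : seq (ncpoly K n)).
Hypothesis hR : graded_pres deg R.

Notation J := (in_ideal R).
Notation le := (wle (@nat_of_ord n)).
Definition ndeg d := normals deg (@nat_of_ord n) J d.
Notation nrm w := (`[< normal deg (@nat_of_ord n) J w >]).

Let sJ := ideal_subspace R.
Let deg_gt0 : forall x, (0 < deg x)%N. Proof. by case: hR. Qed.
Let J_hcomp d p : J p -> J (hcomp deg d p). Proof. exact: ideal_hcomp. Qed.

Lemma nfc_subproof w : exists c : seq 'I_n -> K,
  (forall u, c u != 0 -> le u w) /\
  J (ncsub (ncword K w) (comb (ndeg (wdeg deg w)) c (@ncword K n))).
Proof. exact: (nf_exists deg_gt0 (@ord_inj n) sJ J_hcomp). Qed.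

(** Coefficients of the normal form of [w]. They come from a choice, but are unique on the normal
    words of the degree of [w], by [ndeg_free]. *)
Definition nfc w := projT1 (cid (nfc_subproof w)).

Lemma nfc_le w u : nfc w u != 0 -> le u w.
Proof. by rewrite /nfc; case: cid => c /= [h _] /h. Qed.

Lemma nfcJ w : J (ncsub (ncword K w) (comb (ndeg (wdeg deg w)) (nfc w) (@ncword K n))).
Proof. by rewrite /nfc; case: cid => c /= []. Qed.

Lemma ndeg_free d c : J (comb (ndeg d) c (@ncword K n)) ->
  forall u, u \in ndeg d -> c u = 0.
Proof. exact: (normals_free deg_gt0). Qed.

Lemma mem_ndeg d w : (w \in ndeg d) = nrm w && (wdeg deg w == d).
Proof. exact: mem_normals. Qed.

Lemma uniq_ndeg d : uniq (ndeg d).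
Proof. exact: uniq_normals. Qed.

Lemma nf_homog d p : homog deg d p ->
  J (ncsub p (comb (ndeg d) (fun u => lin (fun w => nfc w u) p) (@ncword K n))).
Proof.
move=> hp; have pw := words_decomp deg_gt0 hp.
apply: (sub_peq sJ (p := comb (words deg d) (nccoef p)
   (fun w => ncsub (ncword K w) (comb (ndeg d) (nfc w) (@ncword K n))))).
  move=> phi; rewrite lin_sub pw !lin_comb.
  under [LHS]eq_bigr do rewrite lin_sub mulrBr lin_comb.
  rewrite sumrB; congr (_ - _).
  under [LHS]eq_bigr do rewrite mulr_sumr.
  rewrite exchange_big; apply: eq_bigr => u _ /=.
  rewrite pw lin_comb mulr_suml; apply: eq_bigr => w _.
  by rewrite !lin_word; ring.
apply: sub_combP => // w; rewrite mem_words // => /eqP wd.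
by have := nfcJ w; rewrite wd.
Qed.

Lemma nf_unique d p c : homog deg d p -> J (ncsub p (comb (ndeg d) c (@ncword K n))) ->
  forall u, u \in ndeg d -> lin (fun w => nfc w u) p = c u.
Proof.
move=> /nf_homog h1 h2 u ud; apply/eqP; rewrite -subr_eq0; apply/eqP; move: u ud.
apply: (ndeg_free (c := fun u => lin (fun w => nfc w u) p - c u)).
apply: (sub_peq sJ) (sub_sub sJ h2 h1) => phi.
rewrite !lin_sub !lin_comb; under [in RHS]eq_bigr do rewrite mulrBl.
by rewrite sumrB; ring.
Qed.

Lemma nf_ideal d p : homog deg d p -> J p ->
  forall u, u \in ndeg d -> lin (fun w => nfc w u) p = 0.
Proof.
move=> hp Jp; apply: (nf_unique (c := fun _ => 0)) => //.
apply: (sub_peq sJ) Jp => phi; rewrite lin_sub lin_comb big1 ?subr0 // => u _.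
by rewrite mul0r.
Qed.

Lemma nfc_normal d w u : w \in ndeg d -> u \in ndeg d -> nfc w u = (u == w)%:R.
Proof.
move=> wd ud; rewrite -[LHS](lin_word (fun w => nfc w u)).
have hw : homog deg d (ncword K w).
  by move: wd; rewrite mem_ndeg => /andP[_ /eqP<-]; apply: homog_word.
apply: (nf_unique (c := fun u => (u == w)%:R) hw) => //.
apply: (sub_peq sJ) (sub_nil sJ) => phi.
by rewrite lin_sub (comb_delta (uniq_ndeg d)) // lin_nil subrr.
Qed.

(** The matrix of left multiplication by [x] between bases of normal words, applied to the
    coordinates of [w]. *)
Lemma nfc_cons d x w u : wdeg deg w = d -> u \in ndeg (deg x + d) ->
  nfc (x :: w) u = \sum_(v <- ndeg d) nfc w v * nfc (x :: v) u.
Proof.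
move=> wd ud; have := ideal_mulw [:: x] [::] (nfcJ w); rewrite wd => h.
have hh : homog deg (deg x + d) (mulw [:: x] [::]
    (ncsub (ncword K w) (comb (ndeg d) (nfc w) (@ncword K n)))).
  apply/homogP => phi h0; rewrite lin_mulw lin_sub lin_word lin_comb h0; last first.
    by rewrite cats0 wdeg_cat wd /wdeg big_seq1.
  rewrite big_seq big1 ?subrr // => v; rewrite mem_ndeg => /andP[_ /eqP vd].
  by rewrite lin_word h0 ?mulr0 // cats0 wdeg_cat vd /wdeg big_seq1.
have := nf_ideal hh h ud; rewrite lin_mulw lin_sub lin_word lin_comb cats0.
move=> /eqP; rewrite subr_eq0 => /eqP->; apply: eq_bigr => v _.
by rewrite lin_word cats0.
Qed.

(** * Candidates for the normal words of one degree: a letter followed by a normal word *)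

Section Candidates.
Variable a : nat.
Hypothesis a_gt0 : (0 < a)%N.
Hypothesis deg_a : forall x, (deg x <= a)%N.

(** Suffixes of normal words are normal, so every normal word of degree [a] is a candidate. Naming
    candidates by letter and position instead of by words lets those of different degrees be
    matched. *)
Definition cidx : seq ('I_n * nat) :=
  [seq (x, k) | x <- enum 'I_n, k <- iota 0 (size (ndeg (a - deg x)))].

Definition cword (c : 'I_n * nat) := c.1 :: nth [::] (ndeg (a - deg c.1)) c.2.

Definition ccomb (f : 'I_n * nat -> K) : ncpoly K n := comb cidx f (fun c => ncword K (cword c)).

Lemma lin_ccomb phi f : lin phi (ccomb f) = \sum_(c <- cidx) f c * phi (cword c).
Proof. by rewrite lin_comb; apply: eq_bigr => c _; rewrite lin_word. Qed.

Lemma mem_cidx c : (c \in cidx) = (c.2 < size (ndeg (a - deg c.1)))%N.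
Proof.
case: c => x k; apply/allpairsPdep/idP => [[y [l [_ + [-> ->]]]]|kx]; first by rewrite mem_iota.
by exists x, k; rewrite mem_enum mem_iota.
Qed.

Lemma map_cword : [seq cword c | c <- cidx] = [seq w <- words deg a | nrm (behead w)].
Proof.
rewrite words_rec // (_ : [seq x <- enum 'I_n | _] = enum 'I_n); last first.
  by apply/all_filterP/allP => x _; apply: deg_a.
rewrite map_flatten filter_flatten -!map_comp; congr flatten; apply: eq_map => x /=.
rewrite filter_map -map_comp; set N := ndeg (a - deg x).
rewrite -[[seq w <- words deg _ | _]]/N -[in RHS](mkseq_nth [::] N) -map_comp.
by apply: eq_map.
Qed.

Lemma uniq_cidx : uniq cidx.
Proof.
apply: allpairs_uniq_dep => [|x _|[x k] [y l] _ _ [-> ->]] //; first exact: enum_uniq.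
exact: iota_uniq.
Qed.

Lemma sorted_cword : sorted le [seq cword c | c <- cidx].
Proof.
rewrite map_cword; apply: sorted_filter; [exact: wle_trans|exact: sorted_words].
Qed.

Lemma normal_behead w : nrm w -> nrm (behead w).
Proof.
case: w => // x w /asboolP h; apply/asboolP.
by apply: (normal_suffix sJ _ J_hcomp (u := [:: x])) h => *; apply: ideal_mulw.
Qed.

Lemma ndeg_cword : ndeg a = [seq cword c | c <- cidx & nrm (cword c)].
Proof.
rewrite -(filter_map cword (fun w => nrm w)) map_cword -filter_predI.
apply: eq_filter => w /=; apply/idP/andP => [h|[]//].
by split=> //; apply: normal_behead.
Qed.

Lemma cword_inj : {in cidx &, injective cword}.
Proof.
move=> [x k] [y l]; rewrite !mem_cidx /= => kx ly [exy]; rewrite -exy in ly *.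
by move=> /eqP; rewrite nth_uniq ?uniq_ndeg // => /eqP->.
Qed.

(** The comparison depends on the indices only, hence is the same in two degrees with equal
    [cidx]. *)
Lemma le_cword c c' : c \in cidx -> c' \in cidx ->
  le (cword c') (cword c) = (index c' cidx <= index c cidx)%N.
Proof.
move=> ci ci'.
have E d : d \in cidx -> cword d = nth [::] [seq cword c | c <- cidx] (index d cidx).
  by move=> di; rewrite (nth_map d) ?index_mem // nth_index.
have mono d d' : d \in cidx -> d' \in cidx -> (index d' cidx <= index d cidx)%N ->
    le (cword d') (cword d).
  move=> di di' h; rewrite (E d) // (E d') //.
  apply: (sorted_leq_nth (@wle_trans _ _) (@wle_refl _ _) _ sorted_cword) => //;
  by rewrite inE size_map index_mem.
apply/idP/idP => [h|]; last exact: mono.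
rewrite leqNgt; apply/negP => lt.
have /(wle_anti (@ord_inj n) h)/cword_inj := mono _ _ ci' ci (ltnW lt).
by move=> /(_ ci' ci) cc; rewrite cc ltnn in lt.
Qed.

Lemma nccoef_ccomb f u : nccoef (ccomb f) u != 0 ->
  exists c, [/\ c \in cidx, u = cword c & f c != 0].
Proof.
rewrite nccoefE lin_ccomb => nz; apply: contrapT => h; case/eqP: nz.
rewrite big_seq big1 // => c ci; case: eqP => [cu|_]; last by rewrite mulr0.
have [->|fc] := eqVneq (f c) 0; first by rewrite mul0r.
by case: h; exists c.
Qed.

Lemma nccoef_ccomb_cword f c : c \in cidx -> nccoef (ccomb f) (cword c) = f c.
Proof.
move=> ci; rewrite nccoefE lin_ccomb (big_rem c) //= eqxx mulr1 big_seq big1 ?addr0 //.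
move=> d; rewrite mem_rem_uniq ?uniq_cidx // inE => /andP[dc di].
by case: eqP => [/(cword_inj di ci) h|_]; rewrite ?mulr0 //; rewrite h eqxx in dc.
Qed.

(** Coordinates, among the candidates, of candidate [c] minus its normal form. *)
Definition cred c c' : K :=
  (c' == c)%:R - (if nrm (cword c') then nfc (cword c) (cword c') else 0).

Lemma wdeg_cword c : c \in cidx -> wdeg deg (cword c) = a.
Proof.
rewrite mem_cidx => ci; rewrite wdeg_cons; have := mem_nth [::] ci.
by rewrite mem_ndeg => /andP[_ /eqP->]; rewrite subnKC.
Qed.

Lemma cred_ideal c : c \in cidx -> J (ccomb (cred c)).
Proof.
move=> ci; have := nfcJ (cword c); rewrite wdeg_cword //.
apply: (sub_peq sJ) => phi.
rewrite lin_ccomb lin_sub lin_word lin_comb ndeg_cword big_map big_filter.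
under [RHS]eq_bigr do rewrite /cred mulrBl.
rewrite sumrB; congr (_ - _).
  rewrite (big_rem c) //= eqxx mul1r big_seq big1 ?addr0 // => d.
  by rewrite mem_rem_uniq ?uniq_cidx // inE => /andP[/negPf->]; rewrite mul0r.
rewrite [LHS]big_mkcond; apply: eq_bigr => d _ /=.
by case: ifP => nd; rewrite ?mul0r // lin_word.
Qed.

End Candidates.

(** * Two degrees whose [D] preceding degrees carry the same data *)

Section Transfer.
Variables (D a b : nat).
Hypothesis D_gt0 : (0 < D)%N.
Hypothesis degD : forall x, (deg x <= D)%N.
Hypothesis relD : forall r, r \in R -> exists2 d, (0 < d <= D)%N & homog deg d r.
Hypotheses (Da : (D <= a)%N) (Db : (D <= b)%N).

Notation N c d := (nth [::] (ndeg c) d).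

Hypothesis size_eq : forall i, (0 < i <= D)%N -> size (ndeg (a - i)) = size (ndeg (b - i)).
Hypothesis nfc_eq : forall i x k l, (0 < i)%N -> (i + deg x <= D)%N ->
  (k < size (ndeg (a - (i + deg x))))%N -> (l < size (ndeg (a - i)))%N ->
  nfc (x :: N (a - (i + deg x)) k) (N (a - i) l) =
  nfc (x :: N (b - (i + deg x)) k) (N (b - i) l).

(* The linear map A_(a-i) -> A_(b-i) matching the k-th normal words. *)
Definition tau i w : ncpoly K n :=
  comb (iota 0 (size (ndeg (a - i)))) (fun l => nfc w (N (a - i) l))
       (fun l => ncword K (N (b - i) l)).

Lemma lin_tau phi i w : lin phi (tau i w) =
  \sum_(0 <= l < size (ndeg (a - i))) nfc w (N (a - i) l) * phi (N (b - i) l).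
Proof.
by rewrite lin_comb /index_iota subn0; apply: eq_bigr => l _; rewrite lin_word.
Qed.

Lemma wdegN c k : (k < size (ndeg c))%N -> wdeg deg (N c k) = c.
Proof. by move=> /(mem_nth [::]); rewrite mem_ndeg => /andP[_ /eqP]. Qed.

(** Modulo the ideal [tau] commutes with left multiplication by a letter, because the matrices of
    that multiplication agree in the two windows. *)
Lemma tau_cons i x w : (0 < i)%N -> (i + deg x <= D)%N ->
  wdeg deg w = (a - (i + deg x))%N ->
  J (ncsub (tau i (x :: w)) (mulw [:: x] [::] (tau (i + deg x) w))).
Proof.
move=> i0 iD wd.
have iD' : (0 < i <= D)%N by lia.
have ixD : (0 < i + deg x <= D)%N by lia.
set A := (a - (i + deg x))%N in wd *.
have aA : (deg x + A = a - i)%N by rewrite /A; lia.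
have bB : (deg x + (b - (i + deg x)) = b - i)%N by lia.
apply: (sub_peq sJ (p := ncscale (-1) (comb (iota 0 (size (ndeg A)))
  (fun k => nfc w (N A k))
  (fun k => ncsub (ncword K (x :: N (b - (i + deg x)) k))
     (comb (ndeg (b - i)) (nfc (x :: N (b - (i + deg x)) k)) (@ncword K n)))))).
  move=> phi; rewrite lin_scale lin_sub lin_mulw !lin_tau -/A lin_comb.
  under eq_bigr do rewrite lin_sub mulrBr lin_word.
  rewrite sumrB mulN1r opprB; congr (_ - _); last first.
    by rewrite /index_iota subn0; apply: eq_bigr => k _; rewrite cats0.
  transitivity (\sum_(0 <= l < size (ndeg (a - i))) \sum_(0 <= k < size (ndeg A))
      nfc w (N A k) * nfc (x :: N A k) (N (a - i) l) * phi (N (b - i) l)).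
    rewrite exchange_big [in RHS]/index_iota subn0 big_seq [RHS]big_seq.
    apply: eq_bigr => k; rewrite mem_iota /= add0n => kA.
    rewrite lin_comb (big_nth [::]) -size_eq // mulr_sumr.
    rewrite big_seq [RHS]big_seq; apply: eq_bigr => l; rewrite mem_index_iota /= => la.
    by rewrite lin_word nfc_eq // mulrA.
  rewrite big_seq [RHS]big_seq; apply: eq_bigr => l; rewrite mem_index_iota /= => la.
  rewrite (nfc_cons wd) ?aA ?mem_nth // (big_nth [::]) mulr_suml.
  by [].
apply: sub_scale => //; apply: sub_combP => // k; rewrite mem_iota add0n /= => kA.
have := nfcJ (x :: N (b - (i + deg x)) k); rewrite wdeg_cons wdegN ?bB //.
by rewrite -size_eq.
Qed.

Lemma tau_cat i u v : (0 < i)%N -> (i + wdeg deg u <= D)%N ->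
  wdeg deg v = (a - (i + wdeg deg u))%N ->
  J (ncsub (tau i (u ++ v)) (mulw u [::] (tau (i + wdeg deg u) v))).
Proof.
elim: u i => [|x u IH] i i0 iD vd.
  apply: (sub_peq sJ) (sub_nil sJ) => phi; rewrite lin_nil lin_sub.
  rewrite lin_mulw /wdeg big_nil addn0 (eq_lin (psi := phi)) ?subrr // => w.
  by rewrite cats0.
rewrite wdeg_cons addnA in iD vd *.
have h1 : J (ncsub (tau i (x :: u ++ v)) (mulw [:: x] [::] (tau (i + deg x) (u ++ v)))).
  by apply: tau_cons => //; [lia|rewrite wdeg_cat; lia].
have /(ideal_mulw [:: x] [::]) h2 := IH (i + deg x)%N ltac:(lia) iD vd.
apply: (sub_peq sJ) (sub_cat sJ h1 h2) => phi.
rewrite lin_cat !(lin_sub, lin_mulw); under [X in _ + (_ - X)]eq_lin do rewrite cats0.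
by rewrite addrA subrK.
Qed.

(** Degree [a] is outside the window, so [tau] acts on the tail only and the first letter is kept.
    The empty word is a default case: it does not occur in the positive degree [a]. *)
Definition theta w : ncpoly K n :=
  if w is x :: w' then mulw [:: x] [::] (tau (deg x) w') else [::].

Definition Theta (p : ncpoly K n) := comb p (fun t => t.1) (fun t => theta t.2).

Lemma lin_Theta phi p : lin phi (Theta p) = lin (fun w => lin phi (theta w)) p.
Proof. by rewrite lin_comb. Qed.

Lemma Theta_peq p q : peq p q -> peq (Theta p) (Theta q).
Proof. by move=> h phi; rewrite !lin_Theta. Qed.

(** If the relation sits inside the tail, [tau] sees a zero element. If it starts the word, its
    remaining letters pass through [tau] within the window, and the image is [r] times [tau d v]
    modulo the ideal. *)
Lemma Theta_gen r u v d : r \in R -> (0 < d <= D)%N -> homog deg d r ->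
  (wdeg deg u + (d + wdeg deg v) = a)%N -> J (Theta (mulw u v r)).
Proof.
move=> rR dD hr; case: u => [|x u] had.
  (* Passing to the component makes every listed term have degree [d], not only those that survive
     cancellation. *)
  have /peq_sym pr := hcomp_id hr.
  rewrite {1}/wdeg big_nil add0n in had.
  apply: (sub_peq sJ (p := Theta (mulw [::] v (hcomp deg d r)))).
    by apply: Theta_peq => phi; rewrite !lin_mulw pr.
  have Jr : J (ncmul (hcomp deg d r) (tau d v)).
    apply: ideal_ncmulr; apply: (sub_peq sJ pr).
    apply: (sub_peq sJ) (ideal_gen [::] [::] rR) => phi.
    by rewrite lin_mulw; apply: eq_lin => w; rewrite cats0.
  apply: (sub_peq sJ (p := comb (hcomp deg d r) (fun t => t.1) (fun t =>
      ncsub (theta (t.2 ++ v)) (mulw t.2 [::] (tau d v))) ++ ncmul (hcomp deg d r) (tau d v))).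
    move=> phi; rewrite lin_cat lin_comb lin_ncmul lin_Theta lin_mulw /lin.
    rewrite -big_split; apply: eq_bigr => t _ /=.
    rewrite -!/(lin _ _) -mulrDr lin_sub lin_mulw; congr (_ * _).
    rewrite [X in _ - X + _](eq_lin (psi := fun w => phi (t.2 ++ w))) ?subrK // => w.
    by rewrite cats0.
  apply: (sub_cat sJ) Jr; apply: sub_combP => // -[c w].
  rewrite mem_filter /= => /andP[/eqP wd _].
  case: w wd => [|y w] wd; first by move: wd dD; rewrite /wdeg big_nil => <-.
  rewrite wdeg_cons in wd.
  have /(ideal_mulw [:: y] [::]) h := @tau_cat (deg y) w v (deg_gt0 y) ltac:(lia) ltac:(lia).
  rewrite wd in h.
  apply: (sub_peq sJ) h => phi; rewrite lin_mulw !lin_sub /= !lin_mulw.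
  by congr (_ - _); apply: eq_lin => z; rewrite ?cats0.
(* Here the multiple of [r] lies in the tail, where its normal form is zero. *)
apply: (sub_peq sJ) (sub_nil sJ) => phi.
rewrite wdeg_cons in had.
rewrite lin_nil lin_Theta lin_mulw /=.
transitivity (lin (fun w => \sum_(0 <= l < size (ndeg (a - deg x)))
   nfc (u ++ w ++ v) (N (a - deg x) l) * phi (x :: N (b - deg x) l)) r); last first.
  by apply: eq_lin => w; rewrite lin_mulw lin_tau; apply: eq_bigr => l _; rewrite cats0.
rewrite lin_sum big_seq big1 // => l; rewrite mem_index_iota /= => la.
rewrite lin_mulr; rewrite (_ : lin _ r = 0) ?mul0r //.
rewrite -(lin_mulw (fun w => nfc w (N (a - deg x) l))).
apply: (@nf_ideal (a - deg x)%N); last by rewrite mem_nth.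
  apply/homogP => psi h0; rewrite lin_mulw; have /homogP := hr; apply => w wd.
  by apply: h0; rewrite !wdeg_cat; lia.
exact: ideal_gen.
Qed.

Lemma Theta_ideal p : J p -> J (Theta (hcomp deg a p)).
Proof.
move: p; apply: ideal_ind.
  split.
  - by move=> p q h; apply: (sub_peq sJ); apply/Theta_peq/hcomp_peq.
  - exact: (sub_nil sJ).
  - move=> p q hp hq; apply: (sub_peq sJ) (sub_cat sJ hp hq) => phi.
    by rewrite lin_cat !(lin_Theta, lin_hcomp, lin_cat).
  - move=> c p hp; apply: (sub_peq sJ) (sub_scale sJ c hp) => phi.
    by rewrite lin_scale !(lin_Theta, lin_hcomp, lin_scale).
move=> r u v rR; have [d dD hr] := relD rR.
have hm : homog deg (wdeg deg u + (d + wdeg deg v)) (mulw u v r).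
  apply/homogP => phi h; rewrite lin_mulw; have /homogP := hr; apply => w wd.
  by apply: h; rewrite !wdeg_cat wd.
have [ha|ha] := eqVneq (wdeg deg u + (d + wdeg deg v))%N a.
  rewrite ha in hm; apply: (sub_peq sJ (p := Theta (mulw u v r))).
    by apply/Theta_peq/peq_sym/hcomp_id.
  exact: Theta_gen dD hr ha.
apply: (sub_peq sJ) (sub_nil sJ) => phi.
rewrite lin_nil lin_Theta lin_hcomp; symmetry.
have /homogP := hm; apply => w wd; by rewrite wd (negPf ha).
Qed.

Let a_gt0 : (0 < a)%N. Proof. exact: leq_trans Da. Qed.
Let b_gt0 : (0 < b)%N. Proof. exact: leq_trans Db. Qed.
Let deg_a x : (deg x <= a)%N. Proof. exact: leq_trans Da. Qed.
Let deg_b x : (deg x <= b)%N. Proof. exact: leq_trans Db. Qed.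

Lemma cidx_eq : cidx b = cidx a.
Proof.
rewrite /cidx; congr flatten; apply: eq_map => x.
by rewrite size_eq // deg_gt0 degD.
Qed.

(** [Theta] sends a candidate of degree [a] to the candidate of degree [b] with the same index,
    since [tau] matches the [k]-th normal words. *)
Lemma ccomb_transfer f : J (ccomb a f) -> J (ccomb b f).
Proof.
move=> /Theta_ideal; apply: (sub_peq sJ) => phi; rewrite lin_Theta.
have hc : homog deg a (ccomb a f).
  apply/homogP => psi h; rewrite lin_ccomb big_seq big1 // => c ci.
  by rewrite h ?mulr0 // wdeg_cword.
rewrite (hcomp_id hc) !lin_ccomb cidx_eq big_seq [RHS]big_seq.
apply: eq_bigr => -[x k]; rewrite mem_cidx /= => kx; congr (_ * _).
rewrite lin_mulw lin_tau (bigD1_seq k) ?iota_uniq ?mem_index_iota //=.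
rewrite (nfc_normal (d := (a - deg x)%N)) ?mem_nth // eqxx mul1r cats0.
rewrite big_seq_cond big1 ?addr0 // => l /andP[]; rewrite mem_index_iota /= => lx lk.
by rewrite (nfc_normal (d := (a - deg x)%N)) ?mem_nth // nth_uniq ?uniq_ndeg // (negPf lk) mul0r.
Qed.

(** If [c] is not normal in degree [a], its reduction involves smaller candidates only; transferred
    to degree [b], it has leading word [cword b c], as the order is read off indices. The converse
    comes from exchanging [a] and [b]. *)
Lemma nrm_transfer c : c \in cidx a -> nrm (cword b c) -> nrm (cword a c).
Proof.
move=> ci; apply: contraTT => na; apply/negP => /asboolP.
have Jb := ccomb_transfer (cred_ideal a_gt0 deg_a ci).
apply: (leading_not_normal Jb).
  rewrite nccoef_ccomb_cword ?cidx_eq // /cred eqxx (negPf na) subr0 oner_eq0 //.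
move=> u /nccoef_ccomb[d [di -> fd]].
have di' := di; rewrite cidx_eq in di'.
have cib : c \in cidx b by rewrite cidx_eq.
rewrite !wdeg_cword //; split=> //.
rewrite le_cword // cidx_eq -le_cword //.
move: fd; rewrite /cred; case: (d =P c) => [-> _|_]; first exact: wle_refl.
rewrite sub0r oppr_eq0; case: ifP => [_ /nfc_le//|_]; by rewrite eqxx.
Qed.

Hypothesis nrm_eq : forall c, c \in cidx a -> nrm (cword b c) = nrm (cword a c).

(** The transferred reduction expresses [cword b c] by normal words, so uniqueness of normal forms
    identifies the coefficients. *)
Lemma nfc_transfer c c' : c \in cidx a -> c' \in cidx a -> nrm (cword a c') ->
  nfc (cword b c) (cword b c') = nfc (cword a c) (cword a c').
Proof.
move=> ci ci' nc'.
have Jb := ccomb_transfer (cred_ideal a_gt0 deg_a ci).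
have ci'b : c' \in cidx b by rewrite cidx_eq.
have hw : homog deg b (ncword K (cword b c)).
  by rewrite -{1}(@wdeg_cword b deg_b c) ?cidx_eq //; apply: homog_word.
(* Coefficients indexed by candidates become a function of words; injectivity of [cword b] leaves at
   most one term in the sum. *)
pose g u := \sum_(d <- cidx b | cword b d == u) nfc (cword a c) (cword a d).
have gE d : d \in cidx b -> g (cword b d) = nfc (cword a c) (cword a d).
  move=> di; rewrite /g -big_filter (_ : [seq _ <- _ | _] = [:: d]) ?big_seq1 //.
  rewrite -(filter_pred1_uniq (uniq_cidx b) di); apply: eq_in_filter => d' di' /=.
  by apply/eqP/eqP => [/(cword_inj di' di)|->].
rewrite -gE // -[LHS](lin_word (fun w => nfc w (cword b c'))).
apply: (nf_unique (d := b) (c := g)) => //; last first.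
  by rewrite ndeg_cword // map_f // mem_filter ci'b nrm_eq // nc'.
apply: (sub_peq sJ) Jb => phi.
rewrite lin_ccomb lin_sub lin_word lin_comb ndeg_cword // big_map big_filter.
under [LHS]eq_bigr do rewrite /cred mulrBl.
rewrite sumrB; congr (_ - _).
  rewrite (big_rem c) ?cidx_eq //= eqxx mul1r big_seq big1 ?addr0 // => d.
  by rewrite mem_rem_uniq ?uniq_cidx // inE => /andP[/negPf->]; rewrite mul0r.
rewrite [RHS]big_mkcond big_seq [RHS]big_seq; apply: eq_bigr => d di /=.
rewrite -nrm_eq -?cidx_eq //; case: ifP => nd; rewrite ?mul0r // lin_word gE //.
Qed.

End Transfer.
End NormalForms.

(** * Regularity of the normal words *)

Lemma index_map_in (T1 T2 : eqType) (f : T1 -> T2) (A : {pred T1}) s x :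
  {in A &, injective f} -> {subset s <= A} -> x \in A -> index (f x) (map f s) = index x s.
Proof.
move=> inj sA xA; elim: s sA => //= y s IH sA.
rewrite IH => [|z zs]; last by apply: sA; rewrite inE zs orbT.
rewrite (_ : (f y == f x) = (y == x)) //.
apply/eqP/eqP => [/inj|->] // -> //; apply: sA; exact: mem_head.
Qed.

Section FiniteData.
Variables (K : fieldType) (n : nat) (deg : 'I_n -> nat) (R : seq (ncpoly K n)).
Hypothesis hR : graded_pres deg R.
Variables (C D : nat) (Fs : seq K).
Notation N d := (ndeg deg R d).
Notation nrm w := (`[< normal deg (@nat_of_ord n) (in_ideal R) w >]).
Hypothesis hC : forall d, (size (N d) <= C)%N.
Hypothesis D_gt0 : (0 < D)%N.
Hypothesis degD : forall x, (deg x <= D)%N.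
Hypothesis relD : forall r, r \in R -> exists2 d, (0 < d <= D)%N & homog deg d r.
Hypothesis hF : forall w u, u \in N (wdeg deg w) -> nfc hR w u \in Fs.

Let deg_gt0 x : (0 < deg x)%N. Proof. by case: hR. Qed.

Definition nw d k := nth [::] (N d) k.

(* Equal to [size (N m)] when the word is not normal. *)
Definition npos m x k := index (x :: nw (m - deg x) k) (N m).

Definition ncoord m x k l := nfc hR (x :: nw (m - deg x) k) (nw m l).

(** Bounded dimensions and the finite list [Fs] of possible coefficients make the data of one degree
    finite; coefficients are stored by their position in [Fs]. *)
Definition datT : finType := ('I_C.+1 *
  {ffun 'I_n * 'I_C.+1 * 'I_C.+1 -> 'I_(size Fs).+1} *
  {ffun 'I_n * 'I_C.+1 -> 'I_C.+1})%type.

Definition inrange m (x : 'I_n) k := (deg x <= m)%N && (k < size (N (m - deg x)))%N.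

Definition dat m : datT :=
  (inord (size (N m)),
   [ffun a : 'I_n * 'I_C.+1 * 'I_C.+1 =>
     if inrange m a.1.1 a.1.2 && (a.2 < size (N m))%N
     then inord (index (ncoord m a.1.1 a.1.2 a.2) Fs) else ord0],
   [ffun a : 'I_n * 'I_C.+1 =>
     if inrange m a.1 a.2 then inord (npos m a.1 a.2) else ord0]).

Lemma ncoord_Fs m x k l : inrange m x k -> (l < size (N m))%N -> ncoord m x k l \in Fs.
Proof.
move=> /andP[xm kx] lm; apply: hF; rewrite wdeg_cons.
have := mem_nth [::] kx; rewrite mem_ndeg // => /andP[_ /eqP->].
by rewrite subnKC // mem_nth.
Qed.

Lemma npos_leC m x k : (npos m x k < C.+1)%N.
Proof. by rewrite ltnS (leq_trans (index_size _ _)). Qed.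

Lemma dat_eq_size m m' : dat m = dat m' -> size (N m) = size (N m').
Proof.
by move=> /(congr1 (fun t : datT => nat_of_ord t.1.1)); rewrite /= !inordK // ltnS.
Qed.

Lemma dat_eq_coord m m' x k l : dat m = dat m' -> inrange m x k -> inrange m' x k ->
  (l < size (N m))%N -> ncoord m x k l = ncoord m' x k l.
Proof.
move=> e r r' lm; have lm' := lm; rewrite (dat_eq_size e) in lm'.
have kC : (k < C.+1)%N by case/andP: r => _ /leq_trans; apply; apply: leqW.
have lC : (l < C.+1)%N by apply: (leq_trans lm); apply: leqW.
have h := congr1 (fun t : datT => nat_of_ord (t.1.2 (x, Ordinal kC, Ordinal lC))) e.
move: h; rewrite /= !ffunE /= r r' lm lm' /= !inordK ?ltnS ?index_size // => h.
have f := ncoord_Fs r lm; have f' := ncoord_Fs r' lm'.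
by rewrite -(nth_index 0 f) h nth_index.
Qed.

Lemma dat_eq_pos m m' x k : dat m = dat m' -> inrange m x k -> inrange m' x k ->
  npos m x k = npos m' x k.
Proof.
move=> e r r'.
have kC : (k < C.+1)%N by case/andP: r => _ /leq_trans; apply; apply: leqW.
have h := congr1 (fun t : datT => nat_of_ord (t.2 (x, Ordinal kC))) e.
by move: h; rewrite /= !ffunE /= r r' !inordK ?npos_leC.
Qed.

Lemma dat_eqP m m' : size (N m) = size (N m') ->
  (forall x k, inrange m x k = inrange m' x k) ->
  (forall x k, inrange m x k -> npos m x k = npos m' x k) ->
  (forall x k l, inrange m x k -> (l < size (N m))%N -> ncoord m x k l = ncoord m' x k l) ->
  dat m = dat m'.
Proof.
move=> es er ep ec; rewrite /dat es; congr (_, _, _).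
  apply/ffunP => -[[x k] l]; rewrite !ffunE /= -er -es.
  by case: ifP => // /andP[r lm]; rewrite ec.
apply/ffunP => -[x k]; rewrite !ffunE /= -er.
by case: ifP => // r; rewrite ep.
Qed.

Definition window d : {ffun 'I_D -> datT} := [ffun i : 'I_D => dat (d + i)].

Lemma window_eqP d d' : window d = window d' <->
  forall i, (i < D)%N -> dat (d + i) = dat (d' + i).
Proof.
split=> [e i iD|h].
  have := congr1 (fun f : {ffun 'I_D -> datT} => f (Ordinal iD)) e.
  by rewrite !ffunE.
by apply/ffunP => i; rewrite !ffunE h.
Qed.

Section Step.
Variables a b : nat.
Hypotheses (Da : (D <= a)%N) (Db : (D <= b)%N).
Hypothesis dat_win : forall i, (0 < i <= D)%N -> dat (a - i) = dat (b - i).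

Lemma win_size i : (0 < i <= D)%N -> size (N (a - i)) = size (N (b - i)).
Proof. by move=> /dat_win/dat_eq_size. Qed.

Lemma win_nfc i x k l : (0 < i)%N -> (i + deg x <= D)%N ->
  (k < size (N (a - (i + deg x))))%N -> (l < size (N (a - i)))%N ->
  nfc hR (x :: nw (a - (i + deg x)) k) (nw (a - i) l) =
  nfc hR (x :: nw (b - (i + deg x)) k) (nw (b - i) l).
Proof.
move=> i0 iD ka la; rewrite !subnDA; apply: dat_eq_coord => //.
- by apply: dat_win; lia.
- by rewrite /inrange -subnDA ka andbT; have := deg_gt0 x; lia.
- rewrite /inrange -subnDA -win_size ?ka ?andbT; last by lia.
  by have := deg_gt0 x; lia.
Qed.

Lemma win_nrm c : c \in cidx deg R a -> nrm (cword deg R b c) -> nrm (cword deg R a c).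
Proof.
exact: (@nrm_transfer K n deg R hR D a b D_gt0 degD relD Da Db win_size win_nfc).
Qed.

End Step.

(** Both lists of normal words arise from the same sublist of candidate indices, so positions and
    coefficients agree. *)
Lemma dat_step a b : (D <= a)%N -> (D <= b)%N ->
  (forall i, (0 < i <= D)%N -> dat (a - i) = dat (b - i)) -> dat a = dat b.
Proof.
move=> Da Db h; have h' i : (0 < i <= D)%N -> dat (b - i) = dat (a - i).
  by move=> /h.
have a0 : (0 < a)%N by apply: leq_trans Da.
have b0 : (0 < b)%N by apply: leq_trans Db.
have deg_a x : (deg x <= a)%N by apply: leq_trans Da.
have deg_b x : (deg x <= b)%N by apply: leq_trans Db.
have wsize := win_size h.
have cidxE : cidx deg R b = cidx deg R a by apply: (cidx_eq hR degD wsize).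
have nrmE c : c \in cidx deg R a -> nrm (cword deg R b c) = nrm (cword deg R a c).
  move=> ci; apply/idP/idP; first exact: (win_nrm Da Db h).
  by apply: (win_nrm Db Da h'); rewrite cidxE.
have nfcE := nfc_transfer D_gt0 degD relD Da Db wsize (win_nfc Da Db h) nrmE.
pose AN := [seq c <- cidx deg R a | nrm (cword deg R a c)].
have Na : N a = map (cword deg R a) AN by rewrite (ndeg_cword hR).
have Nb : N b = map (cword deg R b) AN.
  rewrite (ndeg_cword hR) // cidxE; congr map; apply: eq_in_filter => c.
  exact: nrmE.
have rngE x k : inrange a x k = ((x, k) \in cidx deg R a).
  by rewrite mem_cidx /inrange deg_a.
have ANs : {subset AN <= cidx deg R a} by apply: mem_subseq; apply: filter_subseq.
apply: dat_eqP.
- by rewrite Na Nb !size_map.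
- by move=> x k; rewrite rngE -cidxE mem_cidx /inrange deg_b.
- move=> x k; rewrite rngE => xk.
  rewrite /npos Na Nb -[x :: nw (a - _) _]/(cword deg R a (x, k)).
  rewrite -[x :: nw (b - _) _]/(cword deg R b (x, k)).
  rewrite (index_map_in (@cword_inj _ _ _ R hR a)) //.
  by rewrite (index_map_in (@cword_inj _ _ _ R hR b)) ?cidxE.
- move=> x k l; rewrite rngE => xk la.
  rewrite /ncoord -[x :: nw (a - _) _]/(cword deg R a (x, k)).
  rewrite -[x :: nw (b - _) _]/(cword deg R b (x, k)) /nw Na Nb.
  rewrite Na size_map in la.
  have := mem_nth (x, k) la => cl.
  rewrite !(nth_map (x, k)) // nfcE //; first exact: ANs.
  by move: cl; rewrite mem_filter => /andP[].
Qed.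

Lemma window_step d d' : window d = window d' -> window d.+1 = window d'.+1.
Proof.
move=> /window_eqP h; apply/window_eqP => i iD; rewrite !addSn -!addnS.
have [|Di] := ltnP i.+1 D; first exact: h.
have -> : i.+1 = D by lia.
apply: dat_step; rewrite ?leq_addl // => j /andP[j0 jD].
by rewrite -!addnBA //; apply: h; lia.
Qed.

Lemma window_add d d' k : window d = window d' -> window (d + k) = window (d' + k).
Proof. by move=> h; elim: k => [|k IH]; rewrite ?addn0 // !addnS; apply: window_step. Qed.

Lemma window_dat d d' : window d = window d' -> dat d = dat d'.
Proof. by move=> /window_eqP/(_ _ D_gt0); rewrite !addn0. Qed.

(** All non-normal words share the state [None], which is absorbing because tails of normal words
    are normal. *)
Definition wstate w : option ({ffun 'I_D -> datT} * 'I_C.+1) :=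
  if nrm w then Some (window (wdeg deg w), inord (index w (N (wdeg deg w)))) else None.

Lemma wstate_step x w w' : wstate w = wstate w' -> wstate (x :: w) = wstate (x :: w').
Proof.
have tail v : nrm (x :: v) -> nrm v by apply: normal_behead hR (x :: v).
rewrite {1 2}/wstate; case: ifP => nw1; case: ifP => nw2 // e; last first.
  rewrite /wstate; case: ifP => [/tail|_]; first by rewrite nw1.
  by case: ifP => // /tail; rewrite nw2.
case: e => we ie; set d := wdeg deg w in we ie; set d' := wdeg deg w' in we ie.
have wN : w \in N d by rewrite mem_ndeg // nw1 eqxx.
have wN' : w' \in N d' by rewrite mem_ndeg // nw2 eqxx.
have {}ie : index w (N d) = index w' (N d').
  by move: ie => /(congr1 (@nat_of_ord _)); rewrite !inordK // ltnS (leq_trans (index_size _ _)).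
have we' := window_add (deg x) we.
have de := window_dat we'.
have r : inrange (d + deg x) x (index w (N d)).
  by rewrite /inrange leq_addl addnK index_mem.
have r' : inrange (d' + deg x) x (index w (N d)).
  by rewrite /inrange leq_addl addnK ie index_mem.
have := dat_eq_pos de r r'; rewrite /npos !addnK {2}ie /nw !nth_index // => pe.
(* The recorded position also decides normality: it equals the size of the list exactly for
   non-normal words. *)
have nrmE v c : wdeg deg v = c -> nrm (x :: v) = (index (x :: v) (N (c + deg x)) < size (N (c + deg x)))%N.
  by move=> vc; rewrite index_mem mem_ndeg // wdeg_cons vc addnC eqxx andbT.
rewrite /wstate (nrmE w d) // (nrmE w' d') // pe (dat_eq_size de).
by case: ifP => // _; rewrite !wdeg_cons ![(deg x + _)%N]addnC -/d -/d' we' pe.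
Qed.

Lemma normal_regular : regular_lang (normal deg (@nat_of_ord n) (in_ideal R)).
Proof.
apply: (regular_left_stable wstate_step) => w w'; rewrite /wstate.
case: ifP => [_|/asboolP//]; case: ifP => // /asboolP //.
Qed.

End FiniteData.

(** * The Frobenius map *)

Lemma roots_exhaust (K : fieldType) (P : {poly K}) : P != 0 ->
  exists s : seq K, forall x, root P x -> x \in s.
Proof.
move=> P0; apply: contrapT => h.
have : forall k, exists s : seq K, [/\ uniq s, all (root P) s & size s = k].
  elim=> [|k [s [us rs ss]]]; first by exists [::].
  apply: contrapT => h'; apply: h; exists s => x rx.
  apply: contrapT => /negP xs; apply: h'; exists (x :: s).
  by rewrite /= xs us rx rs ss.
move=> /(_ (size P))[s [us rs ss]].
by have := max_poly_roots P0 rs us; rewrite ss ltnn.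
Qed.

Section Frobenius.
Variables (K : fieldType) (p : nat).
Hypothesis charK : p \in [pchar K].

Lemma frobD k (x y : K) : (x + y) ^+ (p ^ k) = x ^+ (p ^ k) + y ^+ (p ^ k).
Proof.
elim: k => [|k IH]; first by rewrite expn0 !expr1.
by rewrite expnSr !exprM IH -!(pFrobenius_autE charK) rmorphD.
Qed.

Lemma expp_gt0 k : (0 < p ^ k)%N.
Proof. by rewrite expn_gt0 prime_gt0 // (pcharf_prime charK). Qed.

Lemma frob0 k : (0 : K) ^+ (p ^ k) = 0.
Proof. by rewrite expr0n eqn0Ngt expp_gt0. Qed.

Lemma frob_bool k (b : bool) : (b%:R : K) ^+ (p ^ k) = b%:R.
Proof. by case: b; rewrite ?expr1n // frob0. Qed.

Lemma frobN k (x : K) : (- x) ^+ (p ^ k) = - x ^+ (p ^ k).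
Proof.
by apply/eqP; rewrite -subr_eq0 opprK -frobD addNr frob0.
Qed.

Lemma frob_sum k (T : Type) (s : seq T) (P : pred T) (F : T -> K) :
  (\sum_(i <- s | P i) F i) ^+ (p ^ k) = \sum_(i <- s | P i) F i ^+ (p ^ k).
Proof. exact: (big_morph (fun x => x ^+ (p ^ k)) (frobD k) (frob0 k)). Qed.

Lemma frob_inj k : injective (fun x : K => x ^+ (p ^ k)).
Proof.
move=> x y /= /eqP; rewrite -subr_eq0 -frobN -frobD expf_eq0 expp_gt0 /= subr_eq0.
by move/eqP.
Qed.

Lemma frob_mul_fixed k j (x : K) : x ^+ (p ^ k) = x -> x ^+ (p ^ (j * k)) = x.
Proof.
move=> h; elim: j => [|j IH]; first by rewrite mul0n expn0 expr1.
by rewrite mulSn expnD exprM h.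
Qed.

(* The Frobenius map permutes the finitely many roots of a polynomial over the prime field. *)
Lemma algebraic_frob_fixed (x : K) (P : {poly K}) : P != 0 ->
  (forall i, exists k : nat, P`_i = k%:R) -> root P x ->
  exists2 k, (0 < k)%N & x ^+ (p ^ k) = x.
Proof.
move=> P0 hP rx.
have rS y : root P y -> root P (y ^+ p).
  rewrite -(pFrobenius_autE charK) /root => /eqP h.
  have <- : map_poly (Frobenius_aut charK) P = P.
    apply/polyP => i; rewrite coef_map /=; have [k ->] := hP i.
    exact: pFrobenius_aut_nat.
  by rewrite horner_map h rmorph0.
have rk k : root P (x ^+ (p ^ k)).
  by elim: k => [|k IH]; rewrite ?expn0 ?expr1 // expnSr exprM rS.
have [s hs] := roots_exhaust P0.
have [i [j [ij e]]] : exists i j, (i < j)%N /\ x ^+ (p ^ i) = x ^+ (p ^ j).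
  have ltk k : (index (x ^+ (p ^ k)) s < size s)%N by rewrite index_mem hs.
  pose f (i : 'I_(size s).+1) := Ordinal (ltk i).
  have : ~~ injectiveb f.
    by apply/negP => /injectiveP/leq_card; rewrite !card_ord ltnn.
  case/injectivePn => i [j nij /(congr1 val)/= fij].
  have e : x ^+ (p ^ i) = x ^+ (p ^ j).
    by rewrite -[LHS](nth_index 0 (hs _ (rk i))) fij nth_index ?hs.
  have [ij|ji|/val_inj ij] := ltngtP i j.
  - by exists i, j.
  - by exists j, i.
  - by rewrite ij eqxx in nij.
(* Injectivity cancels the first [i] iterations of the Frobenius map. *)
exists (j - i)%N; first by rewrite subn_gt0.
by apply: (@frob_inj i); rewrite -exprM -expnD subnK // ltnW.
Qed.

Lemma algebraic_frob_fixed_seq (s : seq K) : algebraic_over_prime_subfield K ->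
  exists2 k, (0 < k)%N & forall x, x \in s -> x ^+ (p ^ k) = x.
Proof.
move=> alg; elim: s => [|y s [k k0 hk]]; first by exists 1%N.
have [P [P0 [hP rP]]] := alg y.
have [l l0 hl] := algebraic_frob_fixed P0 hP rP.
(* What a power of Frobenius fixes is fixed by its iterates, so the product of the exponents serves
   all elements. *)
exists (k * l)%N; first by rewrite muln_gt0 k0.
move=> x; rewrite inE => /orP[/eqP->|/hk h]; first exact: frob_mul_fixed.
by rewrite mulnC frob_mul_fixed.
Qed.

Lemma frob_fixed_finite k : (0 < k)%N ->
  exists s : seq K, forall x, x ^+ (p ^ k) = x -> x \in s.
Proof.
move=> k0; have p1 : (1 < p ^ k)%N.
  by rewrite -(exp1n k) ltn_exp2r // prime_gt1 // (pcharf_prime charK).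
have P0 : 'X^(p ^ k) - 'X != 0 :> {poly K}.
  apply/eqP => /(congr1 (fun q : {poly K} => q`_(p ^ k))).
  rewrite coefB coefXn coefX eqxx coef0 (gtn_eqF p1) subr0.
  by move/eqP; rewrite oner_eq0.
have [s hs] := roots_exhaust P0; exists s => x hx; apply: hs.
by rewrite /root !hornerE hx subrr.
Qed.

Section FrobeniusIdeal.
Variables (n : nat) (deg : 'I_n -> nat) (R : seq (ncpoly K n)) (k : nat).
Hypothesis hR : graded_pres deg R.
Hypothesis fixR : forall r t, r \in R -> t \in r -> t.1 ^+ (p ^ k) = t.1.

Definition ncfrob (q : ncpoly K n) : ncpoly K n := [seq (t.1 ^+ (p ^ k), t.2) | t <- q].

Lemma nccoef_frob q w : nccoef (ncfrob q) w = nccoef q w ^+ (p ^ k).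
Proof. by rewrite /nccoef big_map frob_sum. Qed.

Lemma ideal_frob q : in_ideal R q -> in_ideal R (ncfrob q).
Proof.
have sI := ideal_subspace R; move: q; apply: ideal_ind.
  split.
  - move=> q r /peqP h; apply: (sub_peq sI); apply/peqP => w.
    by rewrite !nccoef_frob h.
  - exact: sub_nil sI.
  - by move=> q r hq hr; rewrite /ncfrob map_cat; apply: sub_cat.
  - move=> c q hq; have -> : ncfrob (ncscale c q) = ncscale (c ^+ (p ^ k)) (ncfrob q).
      by rewrite /ncfrob /ncscale -!map_comp; apply: eq_map => t /=; rewrite exprMn.
    exact: sub_scale.
move=> r u v rR; rewrite (_ : ncfrob _ = mulw u v r); first exact: ideal_gen.
rewrite /ncfrob /mulw -map_comp; apply/eq_in_map => t tr /=.
by rewrite (fixR rR).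
Qed.

Lemma nfc_frob w u : u \in ndeg deg R (wdeg deg w) -> nfc hR w u ^+ (p ^ k) = nfc hR w u.
Proof.
move=> uN; have sI := ideal_subspace R; have := ideal_frob (nfcJ hR w).
set N := ndeg _ _ _ in uN * => h.
rewrite -[RHS](lin_word (fun w => nfc hR w u)); symmetry.
apply: (nf_unique hR (d := wdeg deg w) (c := fun u => nfc hR w u ^+ (p ^ k)) (@homog_word K n deg w)) => //.
apply: (sub_peq sI) h; apply/peqP => v.
rewrite nccoef_frob !nccoefE !lin_sub frobD frobN !lin_comb !lin_word frob_bool frob_sum.
congr (_ - _).
by apply: eq_bigr => z _; rewrite exprMn lin_word frob_bool.
Qed.

End FrobeniusIdeal.
End Frobenius.

Lemma algebraic_automaton (K : fieldType) p (charK : p \in [pchar K]) n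
    (deg : 'I_n -> nat) (R : seq (ncpoly K n)) :
  algebraic_over_prime_subfield K -> graded_pres deg R -> linear_growth deg R ->
  automaton deg R.
Proof.
move=> alg hR [h [hh [C hC]]].
have hN d : (size (ndeg deg R d) <= C)%N.
  by rewrite -(hilb_dim_unique (hh d) (hilb_dim_letters hR d)).
have [D0 relD] : exists D0, forall r, r \in R -> exists2 d, (0 < d <= D0)%N & homog deg d r.
  case: hR => _; elim: (R) => [|r S IH] hS; first by exists 0%N.
  have [D1 hD1] := IH (fun r0 rS => hS r0 (@mem_behead _ (r :: S) _ rS)).
  have [d [d0 hd]] := hS r (mem_head _ _).
  exists (D1 + d)%N => r'; rewrite inE => /orP[/eqP->|/hD1[d' d'D hd']].
    by exists d => //; lia.
  by exists d' => //; lia.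
(* One bound for the degrees of generators and relations; the successor keeps it positive. *)
pose D := ((\max_x deg x) + D0).+1.
have degD x : (deg x <= D)%N.
  by rewrite ltnW // ltnS (leq_trans (leq_bigmax x)) // leq_addr.
have relD' r : r \in R -> exists2 d, (0 < d <= D)%N & homog deg d r.
  by move=> /relD[d dD hd]; exists d => //; rewrite /D; lia.
have [k k0 hk] := algebraic_frob_fixed_seq charK (flatten [seq [seq t.1 | t <- r] | r <- R]) alg.
have fixR r t : r \in R -> t \in r -> t.1 ^+ (p ^ k) = t.1.
  move=> rR tr; apply: hk; apply/flattenP; exists [seq t.1 | t <- r]; apply: map_f => //.
have [Fs hFs] := frob_fixed_finite charK k0.
exists n, deg, (@letter_poly K n), (@nat_of_ord n); split; first exact: ord_inj.
split; first exact: (letter_poly_homog hR).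
split; first exact: letter_poly_gens.
have := @normal_regular K n deg R hR C D Fs hN (ltn0Sn _) degD relD'.
case=> [w u uN|Q [q0 [delta [F hF]]]]; first by apply: hFs; apply: (nfc_frob charK).
by rewrite -relideal_letter_poly in hF; exists Q, q0, delta, F.
Qed.

(** * A quadratic algebra with six generators *)

(** Named letters, in bijection with ['I_6] by [ltr] and [code], so that definitions can match on
    them. *)
Inductive letter := La | Lb | Lx | Lv of 'I_3.

Definition ltr (y : 'I_6) : letter :=
  match val y with 0 => La | 1 => Lb | 2 => Lx | k.+3 => Lv (inord k) end.

Definition code (l : letter) : 'I_6 :=
  match l with La => inord 0 | Lb => inord 1 | Lx => inord 2 | Lv k => inord (3 + k) end.

Lemma codeK l : ltr (code l) = l.
Proof.
case: l => [|||k]; rewrite /ltr /code /= inordK //.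
  by rewrite add3n inord_val.
by rewrite -ltnS -ltnS; case: k.
Qed.

Lemma ltrK y : code (ltr y) = y.
Proof.
case: y => -[|[|[|k]]] ky; apply: val_inj; rewrite /ltr /code /= inordK //=.
  by rewrite inordK.
by rewrite inordK.
Qed.

Arguments ltr : simpl never.
Arguments code : simpl never.

Notation k1 := (@Ordinal 3 1 isT).

Lemma sum_I3 (V : nmodType) (F : 'I_3 -> V) :
  \sum_k F k = F ord0 + F k1 + F ord_max.
Proof.
rewrite !big_ord_recl big_ord0 addr0 addrA; by congr (_ + F _ + F _); apply: val_inj.
Qed.

Section Counterexample.
Variables (K : fieldType) (t : K).

Definition lam (k : 'I_3) : K := if val k is 0 then 1 + t else if val k is 1 then t else 1.
Definition mu (k : 'I_3) : K := if val k is 0 then 1 else -1.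

(** Words v_k x^i v_l with i > 0 need no rule of their own: [comm_rel] moves the first v next to the
    second. *)
Definition bad (y z : 'I_6) : bool :=
  match ltr y, ltr z with
  | Lb, _ | _, La | Lv _, Lv _ => true
  | _, _ => false
  end.

Notation a := (code La).
Notation b := (code Lb).
Notation x := (code Lx).
Notation v k := (code (Lv k)).

Definition zero_rels : seq (ncpoly K 6) :=
  [seq ncword K [:: yz.1; yz.2] | yz <- [seq yz : 'I_6 * 'I_6 <- enum {: 'I_6 * 'I_6} | bad yz.1 yz.2]].
Definition comm_rel k : ncpoly K 6 := [:: (1, [:: v k; x]); (- lam k, [:: x; v k])].
Definition left_rel : ncpoly K 6 := [seq (mu k, [:: a; v k]) | k <- enum 'I_3].
Definition right_rel k : ncpoly K 6 := [:: (1, [:: v k; b]); (-1, [:: v ord_max; b])].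

Definition exrels : seq (ncpoly K 6) :=
  left_rel :: map comm_rel (enum 'I_3) ++ map right_rel (enum 'I_3) ++ zero_rels.

Lemma exrelsP (P : ncpoly K 6 -> Prop) : P left_rel ->
  (forall k, P (comm_rel k)) -> (forall k, P (right_rel k)) ->
  (forall y z, bad y z -> P (ncword K [:: y; z])) -> forall r, r \in exrels -> P r.
Proof.
move=> h1 h2 h3 h4 r; rewrite inE !mem_cat => /or4P[/eqP->//|/mapP[k _ ->]//|/mapP[k _ ->]//|].
by case/mapP => -[y z]; rewrite mem_filter /= => /andP[/h4 + _] ->.
Qed.

Lemma exrels_left : left_rel \in exrels. Proof. exact: mem_head. Qed.
Lemma exrels_comm k : comm_rel k \in exrels.
Proof. by rewrite inE mem_cat map_f ?orbT // mem_enum. Qed.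
Lemma exrels_right k : right_rel k \in exrels.
Proof. by rewrite inE !mem_cat map_f ?orbT // mem_enum. Qed.
Lemma exrels_zero y z : bad y z -> ncword K [:: y; z] \in exrels.
Proof.
move=> h; rewrite inE !mem_cat; apply/or4P/Or44/mapP; exists (y, z) => //.
by rewrite mem_filter h mem_enum.
Qed.

Definition deg1 := fun _ : 'I_6 => 1%N.

Lemma wdeg1 w : wdeg deg1 w = size w.
Proof. by elim: w => [|y w IH]; rewrite ?wdeg_cons ?IH // /wdeg big_nil. Qed.

Lemma homog_exrels r : r \in exrels -> homog deg1 2 r.
Proof.
move: r; apply: exrelsP => [|k|k|y z _]; apply/homogP => phi h.
- by rewrite /lin big_map big1 // => k _; rewrite h ?mulr0 // wdeg1.
- by rewrite !lin_cons lin_nil /= !h ?wdeg1 // !mulr0 !addr0.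
- by rewrite !lin_cons lin_nil /= !h ?wdeg1 // !mulr0 !addr0.
- by rewrite lin_word h // wdeg1.
Qed.

Lemma graded_exrels : graded_pres deg1 exrels.
Proof. by split=> // r /homog_exrels h; exists 2%N. Qed.

(** * Functionals that vanish on the relations *)

Inductive state := Sa | Sm | Sp | Se.

Section Run.
Variables (fb : bool) (ok : option 'I_3) (rho sig : K).

(* The weighted automaton recognising the words  a? x^i v_k x^j b?  with weight
   rho^i sig^j; [Sa], [Sm], [Sp], [Se] are the states before a, before v_k,
   after v_k and after b. *)
Definition wt s l : K :=
  match s, l with
  | Sa, La => 1
  | Sm, Lx => rho
  | Sm, Lv k => (ok == Some k)%:R
  | Sp, Lx => sig
  | Sp, Lb => fb%:R
  | _, _ => 0
  end.

(** For [ok = None] the state [Sm] is skipped and every x has weight [sig]. *)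
Definition nx s l :=
  match s, l with
  | Sa, La => if ok is Some _ then Sm else Sp
  | Sm, Lv _ => Sp
  | Sp, Lb => Se
  | _, _ => s
  end.

Fixpoint run s (w : seq 'I_6) : K :=
  if w is y :: w' then wt s (ltr y) * run (nx s (ltr y)) w'
  else match s with Sp => (~~ fb)%:R | Se => fb%:R | _ => 0 end.

(** A prefix contributes only a scalar and a state. The second part confines the left relation to
    the beginning of a word: [Sa] is reached with nonzero weight only by the empty prefix. *)
Lemma run_cat s u : exists c s', (forall w, run s (u ++ w) = c * run s' w) /\
  (s' = Sa -> c = 0 \/ s = Sa /\ u = [::]).
Proof.
elim: u s => [|y u IH] s; first by exists 1, s; split=> [w|->]; rewrite ?mul1r //; right.
have [c [s' [h1 h2]]] := IH (nx s (ltr y)).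
exists (wt s (ltr y) * c), s'; split=> [w|/h2[->|[e _]]]; first by rewrite /= h1 mulrA.
  by left; rewrite mulr0.
left; move: e; case: s {h1 h2 IH} => //; case: (ltr y) => [|||k] //=; rewrite ?mul0r //.
by case: ok.
Qed.

Lemma run_bad s y z w : bad y z -> run s [:: y, z & w] = 0.
Proof.
rewrite /bad /=; case: s; case: (ltr y) => [|||k]; case: (ltr z) => [|||l] //= _;
  rewrite ?mul0r ?mulr0 //; case: ok => [j|] /=; rewrite ?mul0r ?mulr0 //.
Qed.

Lemma run_nseq_m i w : run Sm (nseq i x ++ w) = rho ^+ i * run Sm w.
Proof.
by elim: i => [|i IH]; rewrite ?expr0 ?mul1r //= codeK /= IH exprS mulrA.
Qed.

Lemma run_nseq_p j w : run Sp (nseq j x ++ w) = sig ^+ j * run Sp w.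
Proof.
by elim: j => [|j IH]; rewrite ?expr0 ?mul1r //= codeK /= IH exprS mulrA.
Qed.

Lemma run_pv u k w : run Sp (u ++ v k :: w) = 0.
Proof.
elim: u => [|y u IH]; rewrite /= ?codeK ?mul0r //.
case: (ltr y) => [|||l] /=; rewrite ?mul0r ?IH ?mulr0 //.
by case: u {IH} => [|z u]; rewrite /= ?mul0r ?mulr0.
Qed.

End Run.

Definition start (ok : option 'I_3) (fa : bool) := if fa then Sa else if ok is Some _ then Sm else Sp.

Definition pat (fa : bool) i (ok' : option 'I_3) j (fb' : bool) : seq 'I_6 :=
  nseq fa a ++ nseq i x ++ (if ok' is Some k then [:: v k] else [::]) ++ nseq j x ++ nseq fb' b.

Lemma run_pat fb ok rho sig fa fa' i ok' j fb' :
  run fb ok rho sig (start ok fa) (pat fa' i ok' j fb') =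
  ((fa == fa') && (fb == fb') && (ok == ok'))%:R *
  (if ok is Some _ then rho ^+ i * sig ^+ j else sig ^+ (i + j)).
Proof.
have endp : run fb ok rho sig Sp (nseq fb' b) = (fb == fb')%:R.
  by case: fb'; rewrite /= ?codeK /=; case: (fb); rewrite ?mul1r ?mul0r.
have endm : run fb ok rho sig Sm (nseq fb' b) = 0.
  by case: fb' {endp}; rewrite /= ?codeK /= ?mul0r.
have body : run fb ok rho sig (if ok is Some _ then Sm else Sp) (pat false i ok' j fb') =
    ((fb == fb') && (ok == ok'))%:R *
    (if ok is Some _ then rho ^+ i * sig ^+ j else sig ^+ (i + j)).
  rewrite /pat /=; case: ok endp endm => [k|] endp endm.
    rewrite run_nseq_m; case: ok' => [k'|] /=.
      rewrite codeK /= run_nseq_p endp.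
      by case: (fb == fb'); case: (Some k == Some k') => /=; ring.
    by rewrite run_nseq_m endm andbF !mulr0 mul0r.
  rewrite run_nseq_p; case: ok' => [k'|] /=.
    by rewrite codeK /= andbF !mul0r mulr0.
  by rewrite run_nseq_p endp andbT exprD [RHS]mulrC mulrA.
case: fa; case: fa'; rewrite /start.
- by rewrite /pat /= codeK /= mul1r -/(pat false i ok' j fb') body.
- rewrite [RHS]mul0r /pat /=; case: i {body} => [|i] /=; last by rewrite codeK /= mul0r.
  case: ok' => [k|] /=; first by rewrite codeK /= mul0r.
  case: j => [|j] /=; last by rewrite codeK /= mul0r.
  by case: fb' {endp endm} => /=; rewrite ?codeK /= ?mul0r.
- by rewrite [RHS]mul0r /pat /= codeK; case: ok {endp endm body} => /= *; rewrite mul0r.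
- by rewrite body.
Qed.


Lemma run_p_indep fb ok ok' rho rho' sig w :
  run fb ok rho sig Sp w = run fb ok' rho' sig Sp w.
Proof.
elim: w => //= y w IH; case: (ltr y) => [|||l] //=; rewrite ?mul0r ?IH //.
by case: w {IH} => //= z w; rewrite !mul0r.
Qed.

(** From [Sp] only the words x^j b have nonzero weight, and their length fixes j. *)
Lemma run_p_end ok rho w : exists g, forall sig,
  run true ok rho sig Sp w = g * sig ^+ (size w).-1.
Proof.
elim: w => [|y w [g IH]]; first by exists 0 => sig; rewrite mul0r.
rewrite /=; case: (ltr y) => [|||l] /=.
- by exists 0 => sig; rewrite !mul0r.
- case: w {IH} => [|z w]; first by exists 1 => sig.
  by exists 0 => sig; rewrite /= !mul0r mulr0.
- case: w IH => [|z w] IH; first by exists 0 => sig; rewrite /= !mul0r mulr0.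
  by exists g => sig; rewrite IH /= exprS; ring.
- by exists 0 => sig; rewrite !mul0r.
Qed.

(** No x stands between [v l] and [b], and all x before them have weight 1, so [g] does not depend
    on [l]; summed over [k], the right relations vanish. *)
Lemma run_right fb s u w : s = Sa \/ s = Sm -> exists g, forall k l sig,
  run fb (Some k) 1 sig s (u ++ [:: v l, b & w]) = (k == l)%:R * g.
Proof.
elim: u s => [|y u IH] s hs.
  exists (if s is Sm then fb%:R * run fb None 1 1 Se w else 0) => k l sig.
  rewrite /= codeK; case: hs => -> /=; first by rewrite mul0r mulr0.
  rewrite codeK /= (inj_eq Some_inj) eq_sym; congr (_ * (_ * _)).
  by case: w => //= z w; rewrite !mul0r.
case: hs => ->.
  case Ey: (ltr y); [|by exists 0 => k l sig; rewrite /= Ey mul0r mulr0..].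
  have [g hg] := IH Sm (or_intror erefl); exists g => k l sig.
  by rewrite /= Ey /= mul1r hg.
case Ey: (ltr y) => [|||j]; try by exists 0 => k l sig; rewrite /= Ey mul0r mulr0.
  have [g hg] := IH Sm (or_intror erefl); exists g => k l sig.
  by rewrite /= Ey /= mul1r hg.
by exists 0 => k l sig; rewrite /= Ey /= run_pv !mulr0.
Qed.

Definition phiN fa fb w : K := run fb None 1 1 (start None fa) w.

Definition phiV fa fb (c rho sig : 'I_3 -> K) w : K :=
  \sum_k c k * run fb (Some k) (rho k) (sig k) (start (Some k) fa) w.

Lemma phiN_vanish fa fb r u w : r \in exrels -> lin (phiN fa fb) (mulw u w r) = 0.
Proof.
rewrite lin_mulw /phiN; have [c [s' [hc _]]] := run_cat fb None 1 1 (start None fa) u.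
rewrite (eq_lin (psi := fun z => run fb None 1 1 s' (z ++ w) * c)); last first.
  by move=> z; rewrite hc mulrC.
rewrite lin_mulr => rR; rewrite (_ : lin _ r = 0) ?mul0r //.
move: r rR; apply: exrelsP => [|k|k|y z hb].
- rewrite /lin big_map big1 // => k _ /=; rewrite !codeK.
  by case: s' {hc} => /=; rewrite ?mul0r ?mulr0 ?mulr0.
- rewrite !lin_cons lin_nil /= !codeK.
  by case: s' {hc} => /=; rewrite !(mul0r, mulr0, addr0).
- rewrite !lin_cons lin_nil /= !codeK.
  by case: s' {hc} => /=; rewrite !(mul0r, mulr0, addr0).
- by rewrite lin_word run_bad.
Qed.

(** The hypotheses answer the families of relations in turn: the commutations, the left relation at
    the beginning of a word, the right relations. *)
Lemma phiV_vanish (fa fb : bool) (c rho sig : 'I_3 -> K) r u w :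
  (forall k, sig k = lam k * rho k) ->
  (fa -> u = [::] -> \sum_k c k * mu k * run fb (Some k) (rho k) (sig k) Sp w = 0) ->
  (fb -> forall k, c k = 1 /\ rho k = 1) ->
  r \in exrels -> lin (phiV fa fb c rho sig) (mulw u w r) = 0.
Proof.
move=> hs hl hr; rewrite lin_mulw.
have each r' : (forall k s', lin (fun z => run fb (Some k) (rho k) (sig k) s' (z ++ w)) r' = 0) ->
    lin (fun z => phiV fa fb c rho sig (u ++ z ++ w)) r' = 0.
  move=> h; rewrite /phiV lin_sum big1 // => k _.
  have [d [s' [hc _]]] := run_cat fb (Some k) (rho k) (sig k) (start (Some k) fa) u.
  rewrite (eq_lin (psi := fun z => run fb (Some k) (rho k) (sig k) s' (z ++ w) * (c k * d))).
    by rewrite lin_mulr h mul0r.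
  by move=> z; rewrite hc; ring.
move: r; apply: exrelsP => [|k|l|y z hb].
- have [fau|nfau] := boolP (fa && (u == [::])).
    case/andP: fau => fa1 /eqP u0; rewrite -[RHS](hl fa1 u0) u0 /lin big_map.
    rewrite /phiV big_enum /=; under eq_bigr do rewrite mulr_sumr.
    rewrite exchange_big; apply: eq_bigr => k _ /=.
    rewrite fa1 (bigD1 k) //= !codeK /= eqxx big1 ?addr0 => [|l lk].
      by rewrite mulr1n; ring.
    by rewrite !codeK /= (inj_eq Some_inj) eq_sym (negPf lk) !(mul0r, mulr0).
  rewrite /lin big_map big1 // => l _; rewrite /phiV big1 ?mulr0 // => k _.
  have [d [s' [hc h2]]] := run_cat fb (Some k) (rho k) (sig k) (start (Some k) fa) u.
  rewrite hc; case: s' hc h2 => hc h2; rewrite /= ?codeK /= ?mul0r ?mulr0 //.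
  have [->|[e1 e2]] := h2 erefl; first by rewrite mul0r mulr0.
  by move: nfau; rewrite e2 eqxx andbT; move: e1; rewrite /start; case: (fa).
- apply: each => j s'; rewrite !lin_cons lin_nil /= !codeK.
  case: s' => /=; rewrite ?(mul0r, mulr0, addr0) //.
  rewrite (inj_eq Some_inj); case: eqP => [->|_]; last by rewrite !(mul0r, mulr0, addr0).
  by rewrite hs; ring.
- have fbP : ~~ fb \/ fb by case: (fb); [right|left].
  case: fbP => hfb.
    apply: each => j s'; rewrite !lin_cons lin_nil /= !codeK.
    by case: s' => /=; rewrite ?codeK /= ?(negPf hfb) !(mul0r, mulr0, addr0).
  rewrite !lin_cons lin_nil /= addr0 mul1r mulN1r /phiV.
  have [g hg] : exists g, forall k j, run fb (Some k) 1 (sig k) (start (Some k) fa)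
      (u ++ [:: v j, b & w]) = (k == j)%:R * g.
    have [|g hg] := @run_right fb (start (Some ord0) fa) u w.
      by rewrite /start; case: (fa); [left|right].
    by exists g => k j; rewrite -(hg k j (sig k)).
  have E j : \sum_k c k * run fb (Some k) (rho k) (sig k) (start (Some k) fa)
      (u ++ [:: v j, b & w]) = g.
    rewrite (bigD1 j) //= (proj1 (hr hfb j)) (proj2 (hr hfb j)) hg eqxx !mul1r.
    rewrite big1 ?addr0 // => k kj.
    by rewrite (proj2 (hr hfb k)) hg (negPf kj) mul0r mulr0.
  by rewrite !E subrr.
- by apply: each => j s'; rewrite lin_word run_bad.
Qed.


(** * Spanning words of the quadratic algebra *)

Notation I := (in_ideal exrels).
Let sI := ideal_subspace exrels.

Definition eqv c w1 w2 := I (ncsub (ncword K w1) (ncscale c (ncword K w2))).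

Lemma eqv_refl w : eqv 1 w w.
Proof.
by apply: (sub_peq sI) (sub_nil sI) => phi; rewrite lin_sub lin_scale mul1r subrr lin_nil.
Qed.

Lemma eqv_trans c d w2 w1 w3 : eqv c w1 w2 -> eqv d w2 w3 -> eqv (c * d) w1 w3.
Proof.
move=> h1 h2; apply: (sub_peq sI) (sub_cat sI h1 (sub_scale sI c h2)) => phi.
by rewrite !(lin_cat, lin_sub, lin_scale, lin_word); ring.
Qed.

Lemma eqv_ctx u w c w1 w2 : eqv c w1 w2 -> eqv c (u ++ w1 ++ w) (u ++ w2 ++ w).
Proof.
move=> h; apply: (sub_peq sI) (ideal_mulw u w h) => phi.
by rewrite !(lin_mulw, lin_sub, lin_scale, lin_word).
Qed.

Lemma eqv_sym c w1 w2 : c != 0 -> eqv c w1 w2 -> eqv c^-1 w2 w1.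
Proof.
move=> c0 h; apply: (sub_peq sI) (sub_scale sI (- c^-1) h) => phi.
by rewrite !(lin_sub, lin_scale, lin_word); field.
Qed.

Lemma ideal_rel r p : r \in exrels -> peq r p -> I p.
Proof.
move=> rR rp; apply: (sub_peq sI) (ideal_gen [::] [::] rR) => phi.
by rewrite lin_mulw -rp; apply: eq_lin => w; rewrite cats0.
Qed.

Lemma eqv_comm k : eqv (lam k) [:: v k; x] [:: x; v k].
Proof.
apply: (ideal_rel (exrels_comm k)) => phi.
by rewrite !(lin_cons, lin_nil, lin_sub, lin_scale, lin_word) /=; ring.
Qed.

Lemma eqv_right k : eqv 1 [:: v k; b] [:: v ord_max; b].
Proof.
apply: (ideal_rel (exrels_right k)) => phi.
by rewrite !(lin_cons, lin_nil, lin_sub, lin_scale, lin_word) /=; ring.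
Qed.

Lemma eqv_pow k j : eqv (lam k ^+ j) (v k :: nseq j x) (nseq j x ++ [:: v k]).
Proof.
elim: j => [|j IH]; first exact: eqv_refl.
rewrite exprS; apply: (@eqv_trans _ _ (x :: v k :: nseq j x)).
  exact: (eqv_ctx [::] (nseq j x) (eqv_comm k)).
by have := eqv_ctx [:: x] [::] IH; rewrite !cats0.
Qed.

Lemma ideal_word_ctx u w w1 : I (ncword K w1) -> I (ncword K (u ++ w1 ++ w)).
Proof.
by move=> h; apply: (sub_peq sI) (ideal_mulw u w h) => phi; rewrite lin_mulw !lin_word.
Qed.

Lemma ideal_bad y z : bad y z -> I (ncword K [:: y; z]).
Proof. by move=> /exrels_zero h; apply: (ideal_rel h). Qed.

Lemma ideal_eqv c w1 w2 : eqv c w1 w2 -> I (ncword K w2) -> I (ncword K w1).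
Proof.
move=> h1 h2; apply: (sub_peq sI) (sub_cat sI h1 (sub_scale sI c h2)) => phi.
by rewrite !(lin_cat, lin_sub, lin_scale, lin_word); ring.
Qed.

(** Induction by prepending a letter. The only vanishing not visible at the junction is v_k before
    x^i v_l, where v_k is first commuted to the right. *)
Lemma zero_or_pat w : I (ncword K w) \/ exists fa i ok j fb, w = pat fa i ok j fb.
Proof.
elim: w => [|y w [h|[fa [i [ok [j [fb e]]]]]]].
- by right; exists false, 0%N, None, 0%N, false.
- by left; have := ideal_word_ctx [:: y] [::] h; rewrite cats0.
have hd z w' : w = z :: w' -> bad y z -> I (ncword K (y :: w)).
  by move=> -> /ideal_bad/(ideal_word_ctx [::] w').
have [fa1|fa0] := boolP fa.
  left; apply: (hd a); first by rewrite e fa1.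
  by rewrite /bad codeK; case: (ltr y).
rewrite (negPf fa0) in e => {fa0}; rewrite -(ltrK y).
case Ey: (ltr y) => [|||k].
- by right; exists true, i, ok, j, fb; rewrite e.
- case: w e hd => [|z w] e hd; first by right; exists false, 0%N, None, 0%N, true.
  by left; rewrite -Ey ltrK; apply: hd => //; rewrite /bad Ey.
- by right; exists false, i.+1, ok, j, fb; rewrite e.
case: ok e => [l|] e.
  left; rewrite e /pat /=.
  have h : I (ncword K (v k :: nseq i x ++ [:: v l])).
    apply: (ideal_eqv (c := lam k ^+ i) (w2 := nseq i x ++ [:: v k; v l])).
      by have := eqv_ctx [::] [:: v l] (eqv_pow k i); rewrite /= -catA.
    have := @ideal_bad (v k) (v l); rewrite /bad !codeK => /(_ isT)/(ideal_word_ctx (nseq i x) [::]).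
    by rewrite cats0.
  by have := ideal_word_ctx [::] (nseq j x ++ nseq fb b) h; rewrite /= -catA.
right; exists false, 0%N, (Some k), (i + j)%N, fb; rewrite e /pat /= nseqD.
by rewrite -catA.
Qed.

Hypotheses (t0 : t != 0) (t1 : 1 + t != 0).

Lemma lam_neq0 k : lam k != 0.
Proof. by rewrite /lam; case: k => -[|[|[|]]] //= _; rewrite oner_eq0. Qed.

Variable N : nat.

(** The left relation times x^N b, with each v_k moved next to b, is this sum times a x^N v_2 b. *)
Definition degenerate := \sum_k mu k * lam k ^+ N == 0.

(** Four words without v; three with v alone, all x moved to the left; two with a but no b, all x
    moved to the right so that the left relation eliminates v_0; one with b but no a, as the v_k b
    coincide; and, with both, one word that survives exactly when [degenerate] holds. *)
Definition ebasis : seq (seq 'I_6) :=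
  [:: pat false N.+3 None 0 false; pat true N.+2 None 0 false;
      pat false N.+2 None 0 true; pat true N.+1 None 0 true;
      pat false N.+2 (Some ord0) 0 false;
      pat false N.+2 (Some k1) 0 false;
      pat false N.+2 (Some ord_max) 0 false;
      pat true 0 (Some k1) N.+1 false;
      pat true 0 (Some ord_max) N.+1 false;
      pat false N.+1 (Some ord_max) 0 true] ++
  (if degenerate then [:: pat true N (Some ord_max) 0 true] else [::]).

Definition espan p := exists c : 'I_(size ebasis) -> K,
  I (ncsub p (lincomb c (fun i => ncword K (nth [::] ebasis i)))).

Lemma espan_subspace : subspace espan.
Proof.
split.
- move=> p q pq [c hc]; exists c; apply: (sub_peq sI) hc => phi.
  by rewrite !lin_sub pq.
- exists (fun _ => 0); apply: (sub_peq sI) (sub_nil sI) => phi.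
  by rewrite lin_sub !lin_nil lin_lincomb big1 ?subrr // => i _; rewrite mul0r.
- move=> p q [c hc] [d hd]; exists (fun i => c i + d i).
  apply: (sub_peq sI) (sub_cat sI hc hd) => phi.
  rewrite !(lin_cat, lin_sub, lin_lincomb); under [in RHS]eq_bigr do rewrite mulrDl.
  by rewrite big_split /=; ring.
- move=> d p [c hc]; exists (fun i => d * c i).
  apply: (sub_peq sI) (sub_scale sI d hc) => phi.
  rewrite !(lin_scale, lin_sub, lin_lincomb); under [in RHS]eq_bigr do rewrite -mulrA.
  by rewrite -mulr_sumr; ring.
Qed.

Lemma espan_ideal p q : I (ncsub p q) -> espan q -> espan p.
Proof.
move=> h [c hc]; exists c; apply: (sub_peq sI) (sub_cat sI h hc) => phi.
by rewrite lin_cat !lin_sub; ring.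
Qed.

Lemma espan_eqv c w1 w2 : eqv c w1 w2 -> espan (ncword K w2) -> espan (ncword K w1).
Proof. by move=> h1 h2; apply: espan_ideal h1 _; apply: sub_scale h2; apply: espan_subspace. Qed.

Lemma espan_zero w : I (ncword K w) -> espan (ncword K w).
Proof.
move=> h; apply: (espan_ideal (q := [::])); last exact: sub_nil espan_subspace.
by apply: (sub_peq sI) h => phi; rewrite lin_sub lin_nil subr0.
Qed.

Lemma espan_mem w : w \in ebasis -> espan (ncword K w).
Proof.
move=> wB; have iw : (index w ebasis < size ebasis)%N by rewrite index_mem.
exists (fun i => (i == Ordinal iw)%:R); apply: (sub_peq sI) (sub_nil sI) => phi.
rewrite lin_nil lin_sub lin_lincomb (bigD1 (Ordinal iw)) //= eqxx mul1r nth_index //.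
by rewrite big1 ?addr0 ?subrr // => i /negPf->; rewrite mul0r.
Qed.

Lemma I3P (k : 'I_3) : [\/ k = ord0, k = k1 | k = ord_max].
Proof.
case: k => -[|[|[|]]] // hk; [constructor 1|constructor 2|constructor 3];
  exact: val_inj.
Qed.

Lemma espan_nth i w : (i < 10)%N -> nth [::] ebasis i = w -> espan (ncword K w).
Proof.
move=> i10 <-; apply/espan_mem/mem_nth.
by rewrite /ebasis size_cat; apply: leq_trans i10 _; apply: leq_addr.
Qed.

Lemma eqv_push_right u w i k j :
  eqv (lam k ^+ j) (u ++ nseq i x ++ v k :: nseq j x ++ w) (u ++ nseq (i + j) x ++ v k :: w).
Proof.
have := eqv_ctx (u ++ nseq i x) w (eqv_pow k j).
by rewrite nseqD -!catA /= -?catA.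
Qed.

Lemma espan_pat_TV k j : j = N.+1 -> espan (ncword K (pat true 0 (Some k) j false)).
Proof.
move=> ->; case: (I3P k) => ->; last first.
- exact: (@espan_nth 8).
- exact: (@espan_nth 7).
pose w := nseq N.+1 x.
have patE l : pat true 0 (Some l) N.+1 false = [:: a; v l] ++ w by rewrite /pat /= cats0.
have S l : l != ord0 -> espan (ncword K ([:: a; v l] ++ w)).
  by rewrite -patE; case: (I3P l) => -> // _; [exact: (@espan_nth 7)|exact: (@espan_nth 8)].
apply: (espan_ideal (q := comb [:: k1; ord_max] (fun _ : 'I_3 => 1)
   (fun l => ncword K ([:: a; v l] ++ w)))); last first.
  apply: sub_combP; first exact: espan_subspace.
  move=> l; rewrite !inE => /orP[/eqP->|/eqP->]; exact: S.
rewrite patE; apply: (sub_peq sI) (ideal_gen [::] w exrels_left) => phi.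
rewrite lin_mulw lin_sub lin_word lin_comb {1}/lin big_map big_enum sum_I3.
rewrite !(big_cons, big_nil) !lin_word /mu /=.
by ring.
Qed.

Lemma espan_pat fa i ok j fb : size (pat fa i ok j fb) = N.+3 ->
  espan (ncword K (pat fa i ok j fb)).
Proof.
rewrite /pat !size_cat !size_nseq; case: ok => [k|] /= sz.
  case: fb sz => sz; last first.
    case: fa sz => /= sz.
      (* To stand next to a, the letter v_k moves left, which uses that [lam k] is invertible. *)
      apply: (espan_eqv (c := (lam k ^+ i)^-1) (w2 := pat true 0 (Some k) (i + j) false)).
        have h := eqv_ctx [:: a] (nseq j x) (eqv_pow k i).
        have := eqv_sym (expf_neq0 i (lam_neq0 k)) h.
        by rewrite /pat /= !cats0 nseqD -catA.
      by apply: espan_pat_TV; lia.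
    apply: espan_eqv (eqv_push_right [::] [::] i k j) _.
    have -> : (i + j = N.+2)%N by lia.
    by case: (I3P k) => ->; [exact: (@espan_nth 4)|exact: (@espan_nth 5)|exact: (@espan_nth 6)].
  case: fa sz => /= sz.
    have hE l i' j' : (i' + j' = N)%N -> eqv (lam l ^+ j')
       (a :: nseq i' x ++ v l :: nseq j' x ++ [:: b]) (a :: nseq N x ++ [:: v ord_max; b]).
      move=> ij; rewrite -[lam l ^+ _]mulr1.
      apply: (eqv_trans (eqv_push_right [:: a] [:: b] i' l j')); rewrite ij.
      by have := eqv_ctx (a :: nseq N x) [::] (eqv_right l); rewrite !cats0.
    apply: espan_eqv (hE k i j _) _; first by lia.
    have [dg|ndg] := boolP degenerate.
      by apply: espan_mem; rewrite /ebasis dg mem_cat mem_head orbT.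
    (* The left relation times x^N b, minus the rewritings of its terms, leaves [s] times [E]; for
       nonzero [s] this puts [E] in the ideal. *)
    apply: espan_zero; set E := a :: nseq N x ++ _.
    have Jl := ideal_gen [::] (nseq N x ++ [:: b]) exrels_left.
    have Js : I (comb (enum 'I_3) mu (fun l => ncsub (ncword K (a :: v l :: nseq N x ++ [:: b]))
                 (ncscale (lam l ^+ N) (ncword K E)))).
      by apply: sub_comb => // l; apply: (hE l 0%N N).
    move: ndg; rewrite /degenerate; set s := \sum_k _ => s0.
    apply: (sub_peq sI) (sub_scale sI s^-1 (sub_sub sI Jl Js)) => phi.
    rewrite lin_scale lin_sub lin_mulw lin_word lin_comb.
    under [X in _ - X]eq_bigr do rewrite lin_sub lin_scale !lin_word mulrBr.
    rewrite sumrB /left_rel {1}/lin big_map opprB addrC subrK big_enum.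
    under eq_bigr do rewrite mulrA.
    by rewrite -mulr_suml -/s mulKf.
  apply: espan_eqv (eqv_push_right [::] [:: b] i k j) _.
  have -> : (i + j = N.+1)%N by lia.
  apply: (espan_eqv (c := 1) (w2 := nseq N.+1 x ++ [:: v ord_max; b])).
    by have := eqv_ctx (nseq N.+1 x) [::] (eqv_right k); rewrite !cats0.
  exact: (@espan_nth 9).
have -> : nseq i x ++ nseq j x ++ nseq fb b = nseq (i + j) x ++ nseq fb b.
  by rewrite nseqD catA.
case: fa sz; case: fb => /= sz.
- have -> : (i + j = N.+1)%N by lia.
  exact: (@espan_nth 3).
- have -> : (i + j = N.+2)%N by lia.
  exact: (@espan_nth 1).
- have -> : (i + j = N.+2)%N by lia.
  exact: (@espan_nth 2).
- have -> : (i + j = N.+3)%N by lia.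
  exact: (@espan_nth 0).
Qed.

Lemma espan_homog g : homog deg1 N.+3 g -> espan g.
Proof.
have d1 (y : 'I_6) : (0 < deg1 y)%N by [].
move=> hg; have hw := words_decomp d1 hg.
apply: (sub_peq espan_subspace (peq_sym hw)).
apply: sub_combP => [|w]; first exact: espan_subspace.
rewrite mem_words // wdeg1 => /eqP sw.
have [/espan_zero//|[fa [i [ok [j [fb e]]]]]] := zero_or_pat w.
by rewrite e in sw *; apply: espan_pat.
Qed.


(** * Functionals dual to the spanning words *)

Lemma phiN_pat fa fb fa' i ok j fb' :
  phiN fa fb (pat fa' i ok j fb') = ((fa == fa') && (fb == fb') && (None == ok))%:R.
Proof. by rewrite /phiN run_pat expr1n mulr1. Qed.

Lemma phiV_patN fa fb c rho sig fa' i j fb' :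
  phiV fa fb c rho sig (pat fa' i None j fb') = 0.
Proof. by rewrite /phiV big1 // => k _; rewrite run_pat andbF mul0r mulr0. Qed.

Lemma phiV_pat fa fb c rho sig fa' i k j fb' :
  phiV fa fb c rho sig (pat fa' i (Some k) j fb') =
  ((fa == fa') && (fb == fb'))%:R * (c k * rho k ^+ i * sig k ^+ j).
Proof.
rewrite /phiV (bigD1 k) //= run_pat eqxx andbT big1 ?addr0; first by ring.
move=> l lk; rewrite run_pat (inj_eq Some_inj) (negPf lk) andbF mul0r mulr0 //.
Qed.

Let ones (k : 'I_3) : K := 1.

(** In the order of [ebasis]. For words with a and without b, [sig = 1] turns the left relation into
    the condition [\sum_k c k * mu k = 0]; the two choices of [c] solve it and are dual to v_1 and
    v_2. *)
Definition edual : seq (seq 'I_6 -> K) :=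
  [:: phiN false false; phiN true false; phiN false true; phiN true true;
      phiV false false (fun k => (k == ord0)%:R) ones lam;
      phiV false false (fun k => (k == k1)%:R) ones lam;
      phiV false false (fun k => (k == ord_max)%:R) ones lam;
      phiV true false (fun k => (k != ord_max)%:R) (fun k => (lam k)^-1) ones;
      phiV true false (fun k => (k != k1)%:R) (fun k => (lam k)^-1) ones;
      phiV false true ones ones lam; phiV true true ones ones lam].

Lemma size_ebasis : size ebasis = if degenerate then 11 else 10.
Proof. by rewrite /ebasis size_cat; case: ifP. Qed.

Lemma edual_ebasis i j : (i < size ebasis)%N -> (j < size ebasis)%N ->
  nth (fun _ => 0) edual i (nth [::] ebasis j) = (i == j)%:R.
Proof.
have phiE := (phiN_pat, phiV_patN, phiV_pat).
have simp := (expr1n, expr0, mulr1, mul1r, mul0r, mulr0).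
rewrite size_ebasis /ebasis; case: ifP => _.
  by do 11?[case: i => [|i]] => // _; do 11?[case: j => [|j]] => // _;
    rewrite [nth _ edual _]/= [nth _ _ _]/= !phiE /ones /= ?simp.
by do 10?[case: i => [|i]] => // _; do 10?[case: j => [|j]] => // _;
  rewrite [nth _ edual _]/= [nth _ _ _]/= !phiE /ones /= ?simp.
Qed.

(** The restriction to total degree [d] is for the last functional: it is only guaranteed to kill
    the left relation times [w] when [w] has the length imposed by degree [N + 3]. *)
Lemma vanish_homog d phi p :
  (forall r u w, r \in exrels -> (size u + (2 + size w) = d)%N -> lin phi (mulw u w r) = 0) ->
  I p -> homog deg1 d p -> lin phi p = 0.
Proof.
move=> h Ip hp; pose psi w := if size w == d then phi w else 0.
rewrite (lin_homog (psi := psi) hp) => [|w]; last by rewrite /psi wdeg1 => ->; rewrite eqxx.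
apply: ideal_lin Ip => r u w rR; rewrite lin_mulw.
have hr := homog_exrels rR.
have [e|ne] := eqVneq (size u + (2 + size w))%N d.
  rewrite -[RHS](h r u w) // lin_mulw; apply: (lin_homog hr) => z; rewrite wdeg1 => sz.
  by rewrite /psi !size_cat sz e eqxx.
have /homogP := hr; apply => z; rewrite wdeg1 => sz.
by rewrite /psi !size_cat sz (negPf ne).
Qed.

Lemma edual_vanish i p : (i < size ebasis)%N -> I p -> homog deg1 N.+3 p ->
  lin (nth (fun _ => 0) edual i) p = 0.
Proof.
have left_one c w : \sum_k c k * mu k = 0 ->
    \sum_k c k * mu k * run false (Some k) (lam k)^-1 1 Sp w = 0.
  move=> hc; under eq_bigr => k _ do
    rewrite (run_p_indep false (Some k) None (lam k)^-1 1 1 w).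
  by rewrite -mulr_suml hc mul0r.
rewrite size_ebasis => id; apply: vanish_homog => r u w rR sz.
do 10![case: i id => [|i] id; first by
  [exact: phiN_vanish | apply: phiV_vanish rR => //= k; rewrite /ones ?mulr1 ?mulfV ?lam_neq0 //
  |apply: phiV_vanish rR => [k|_ _|//]; [by rewrite /ones mulfV ?lam_neq0
     |by apply: left_one; rewrite sum_I3 /mu /=; ring]]].
(* The eleventh functional exists only in the degenerate case, which is exactly its condition for
   the left relation. *)
case: i id => [|i]; case: ifP => // dg _.
apply: phiV_vanish rR => [k|_ u0|//]; first by rewrite /ones mulr1.
have [g hg] := run_p_end None 1 w.
under eq_bigr => k _ do rewrite (run_p_indep true (Some k) None (ones k) 1 (lam k) w) hg mul1r.
have -> : (size w).-1 = N by move: sz; rewrite u0 /=; lia.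
under eq_bigr do rewrite mulrCA.
by rewrite -mulr_sumr (eqP dg) mulr0.
Qed.

Lemma wdeg_ebasis i : (i < size ebasis)%N -> wdeg deg1 (nth [::] ebasis i) = N.+3.
Proof.
rewrite wdeg1 size_ebasis /ebasis; case: ifP => _.
  by do 11?[case: i => [|i]] => // _; rewrite /= /pat ?size_cat /= ?size_cat ?size_nseq /=; lia.
by do 10?[case: i => [|i]] => // _; rewrite /= /pat ?size_cat /= ?size_cat ?size_nseq /=; lia.
Qed.

Lemma hilb_dim_exrels : hilb_dim deg1 exrels N.+3 (if degenerate then 11 else 10).
Proof.
rewrite -size_ebasis; exists (fun i => ncword K (nth [::] ebasis i)); split; [|split].
- by move=> i; rewrite -(wdeg_ebasis (ltn_ord i)); apply: homog_word.
- move=> c hc i; have := edual_vanish (ltn_ord i) hc.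
  rewrite lin_lincomb (bigD1 i) //= lin_word edual_ebasis // eqxx mulr1 big1 ?addr0.
    apply; apply/homogP => phi h; rewrite lin_lincomb big1 // => j _.
    by rewrite lin_word h ?mulr0 // wdeg_ebasis.
  move=> j ji; rewrite lin_word edual_ebasis //.
  by rewrite eq_sym -val_eqE in ji; rewrite (negPf ji) mulr0.
- by move=> g /espan_homog.
Qed.

End Counterexample.

(** * Irrationality *)

(** A denominator of degree [d] imposes a linear recurrence on [d + 1] consecutive terms. A window
    without powers of [p] gives the recurrence for the constant 10; the window starting at a power
    differs from it by the leading coefficient of [Q], which would have to vanish. *)
Lemma sparse_not_rational p (eps : nat -> bool) (h : nat -> nat) : prime p ->
  (forall N, eps N <-> exists s, N = (p ^ s)%N) ->
  (forall N, h N.+3 = if eps N then 11 else 10) -> ~ rational_series h.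
Proof.
move=> pp he hh [P [Q [Q0 hQ]]].
have [d dQ] : exists d, size Q = d.+1.
  by exists (size Q).-1; rewrite prednK // size_poly_gt0.
have [L [dL PL]] : exists L, (d < L)%N /\ (size P <= L)%N.
  by exists (d.+1 + size P)%N; rewrite leq_addr leq_addl.
(* As [d < L < q], the window from [q + 1] to [q + 1 + d] lies strictly between [q] and [2 q], where
   there is no power of [p]. *)
have [q qE] : exists q, q = (p ^ L)%N by exists (p ^ L)%N.
have Lq : (L < q)%N by rewrite qE ltn_expl // prime_gt1.
have gap N : (q < N < q + q)%N -> ~~ eps N.
  case/andP => qN Nq; apply/negP => /he[s eN]; move: qN Nq; rewrite eN qE.
  rewrite ltn_exp2l ?prime_gt1 // => Ls.
  have : (p ^ L.+1 <= p ^ s)%N by rewrite leq_exp2l ?prime_gt1.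
  by rewrite expnS; have := prime_gt1 pp; nia.
have hN N : (h N.+3)%:R = 10%:R + (eps N)%:R :> rat by rewrite hh; case: (eps N).
have trunc k : (d <= k)%N -> \sum_(i < k.+1) Q`_i * (h (k - i)%N)%:R =
    \sum_(i < d.+1) Q`_i * (h (k - i)%N)%:R.
  move=> dk; rewrite -!(big_mkord xpredT (fun i => Q`_i * (h (k - i)%N)%:R)).
  rewrite (big_cat_nat (n := d.+1)) //= [X in _ + X]big_nat_cond [X in _ + X]big1 ?addr0 // => i.
  by rewrite -dQ andbT => /andP[iQ _]; rewrite nth_default ?mul0r.
have sumQ j : (j <= 1)%N -> \sum_(i < d.+1) Q`_i * (10%:R + (eps (q + j + (d - i))%N)%:R) = 0.
  move=> j1; have := hQ (q + j + d)%N.+3; rewrite trunc; last by lia.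
  rewrite [P`_ _]nth_default; last by apply: (leq_trans PL); lia.
  move=> h0; rewrite -[RHS]h0; apply: eq_bigr => -[i id] _ /=.
  have -> : ((q + j + d).+3 - i)%N = (q + j + (d - i)).+3%N by lia.
  by rewrite hN.
have s1 : \sum_(i < d.+1) Q`_i * 10%:R = 0 :> rat.
  rewrite -[RHS](sumQ 1%N) //; apply: eq_bigr => -[i id] _ /=.
  by rewrite (negPf (gap _ _)) ?addr0 //; lia.
have := sumQ 0%N isT; under eq_bigr do rewrite mulrDr.
rewrite big_split /= s1 add0r big_ord_recr /= subnn !addn0.
have -> : eps q by apply/he; exists L.
rewrite big1 => [|[i id] _ /=]; last first.
  by rewrite (negPf (gap _ _)) ?mulr0 //; lia.
rewrite add0r mulr1 => /eqP; rewrite (_ : Q`_d = lead_coef Q) ?lead_coef_eq0; last by rewrite lead_coefE dQ.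
by rewrite (negPf Q0).
Qed.

Section Transcendental.
Variables (K : fieldType) (p : nat) (t : K).
Hypothesis charK : p \in [pchar K].
Hypothesis trans : forall P : {poly K}, P != 0 ->
  (forall i, exists k : nat, P`_i = k%:R) -> ~~ root P t.

Lemma transcendental_neq0 : t != 0.
Proof.
have X0 : 'X != 0 :> {poly K} by rewrite -size_poly_eq0 size_polyX.
have := trans X0; rewrite /root hornerX; apply => i.
by exists (i == 1%N); rewrite coefX.
Qed.

Lemma transcendental_add1_neq0 : 1 + t != 0.
Proof.
have P0 : 'X + 1%:P != 0 :> {poly K} by rewrite -size_poly_eq0 size_XaddC.
rewrite addrC; have := trans P0; rewrite /root !hornerE; apply => i.
by exists ((i == 1) + (i == 0))%N; rewrite coefD coefX coefC natrD; case: (i == 0)%N.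
Qed.

Lemma degenerateE N : degenerate t N = ((1 + t) ^+ N - t ^+ N - 1 == 0).
Proof. by rewrite /degenerate sum_I3 /mu /lam /= expr1n mul1r !mulN1r. Qed.

(* Lech's example of a linear recurrence whose zero set is not eventually periodic. *)
Lemma degenerateP N : degenerate t N <-> exists s, N = (p ^ s)%N.
Proof.
have pp := pcharf_prime charK.
rewrite degenerateE; split=> [|[s ->]]; last first.
  by rewrite (frobD charK) expr1n addrK subrr.
case: (posnP N) => [->|N0]; first by rewrite !expr0 subrr sub0r oppr_eq0 oner_eq0.
(* For N = p^s m with m prime to p, the expression is the p^s-th power of (1 + t)^m - t^m - 1. *)
have [m cop eN] := pfactor_coprime pp N0; set s := logn p N in eN.
rewrite {1 2}eN !exprM -(expr1n _ (p ^ s)) -2!(frobN charK) -!(frobD charK) expf_eq0.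
case/andP => _ /eqP; rewrite expr1n => hm; exists s.
suff m1 : m = 1%N by rewrite eN m1 mul1n.
apply/eqP; apply: contraT => m1.
have {}m1 : (1 < m)%N.
  by case: m m1 cop {eN hm} => [|[|]] //; rewrite /coprime gcdn0 => _ /eqP e1; rewrite e1 in pp.
have [n nE] : exists n, m = n.+1 by exists m.-1; rewrite prednK // ltnW.
subst m.
(* Coefficients of (1 + X)^m - X^m - 1 with m = n + 1. For m > 1 its linear coefficient m is nonzero
   in K, so a root t would be algebraic. *)
pose E i : K := if i is 0 then 0 else 'C(n.+1, i)%:R.
have P0 : \poly_(i < n.+1) E i != 0.
  apply/eqP => /(congr1 (fun P : {poly K} => P`_1)).
  rewrite coef_poly m1 coef0 /E bin1 => /eqP.
  by rewrite -(dvdn_pcharf charK) => pm; move: cop; rewrite prime_coprime // pm.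
have hP i : exists k : nat, (\poly_(i < n.+1) E i)`_i = k%:R.
  rewrite coef_poly; case: ifP => _; last by exists 0%N.
  by case: i => [|i]; [exists 0%N|exists 'C(n.+1, i.+1)].
have E0 : \sum_(i < n.+1) E i * t ^+ i = (t + 1) ^+ n.+1 - t ^+ n.+1 - 1.
  rewrite exprD1n [in RHS]big_ord_recr /= binn mulr1n addrK.
  rewrite !big_ord_recl /= bin0 expr0 mulr1n mul0r add0r [RHS]addrC addKr.
  by apply: eq_bigr => i _; rewrite mulr_natl.
have /negP[] := trans P0 hP.
by rewrite /root horner_poly E0 [t + 1]addrC hm.
Qed.

End Transcendental.

Lemma transcendental_counterexample (K : fieldType) p (charK : p \in [pchar K]) :
  ~ algebraic_over_prime_subfield K ->
  exists R : seq (ncpoly K 6),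
    let deg := fun _ : 'I_6 => 1%N in
    (forall r, r \in R -> homog deg 2 r) /\
    linear_growth deg R /\ ~ rational_hilb deg R.
Proof.
move=> /existsNP[t ht].
have trans (P : {poly K}) : P != 0 ->
    (forall i, exists k : nat, P`_i = k%:R) -> ~~ root P t.
  by move=> P0 hP; apply/negP => rP; apply: ht; exists P.
have t0 := transcendental_neq0 trans; have t1 := transcendental_add1_neq0 trans.
have hh N := hilb_dim_exrels t0 t1 N.
exists (exrels t); split; first exact: homog_exrels.
split.
  pose h d := size (normals deg1 (@nat_of_ord 6) (in_ideal (exrels t)) d).
  have hhd d : hilb_dim deg1 (exrels t) d (h d).
    exact: (hilb_dim_letters (graded_exrels t) d).
  (* Dimensions are computed from degree 3 on; the first three values are put into the bound. *)
  exists h; split=> //; exists (h 0 + h 1 + h 2 + 11)%N.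
  case=> [|[|[|N]]]; try by lia.
  by rewrite (hilb_dim_unique (hhd N.+3) (hh N)); case: ifP => _; lia.
case=> h [hhd]; apply: (@sparse_not_rational p (degenerate t)).
- exact: pcharf_prime charK.
- exact: degenerateP charK trans.
- by move=> N; apply: hilb_dim_unique (hhd N.+3) (hh N).
Qed.

Theorem theorem1p1 (K : fieldType) (p : nat) (charK : p \in [pchar K]) :
  let cond_i := forall (n : nat) (deg : 'I_n -> nat) (R : seq (ncpoly K n)),
      graded_pres deg R -> linear_growth deg R -> rational_hilb deg R in
  let cond_ii := forall (n : nat) (deg : 'I_n -> nat) (R : seq (ncpoly K n)),
      graded_pres deg R -> linear_growth deg R -> automaton deg R in
  let cond_iii := algebraic_over_prime_subfield K in
  ((cond_i <-> cond_ii) /\ (cond_ii <-> cond_iii)) /\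
  (~ cond_iii ->
     exists R : seq (ncpoly K 6),
       let deg := fun _ : 'I_6 => 1%N in
       (forall r, r \in R -> homog deg 2 r) /\
       linear_growth deg R /\ ~ rational_hilb deg R).
Proof.
move=> cond_i cond_ii cond_iii.
have h21 : cond_ii -> cond_i.
  by move=> h n deg R gR lR; apply: automaton_rational => //; apply: h.
have h32 : cond_iii -> cond_ii.
  by move=> alg n deg R gR lR; exact: (algebraic_automaton charK alg gR lR).
have h4 := @transcendental_counterexample K p charK.
have h13 : cond_i -> cond_iii.
  move=> h1; apply: contrapT => /h4[R [hR [lR nR]]]; apply: nR; apply: h1 => //.
  by split=> // r rR; exists 2%N; split=> //; apply: hR.
split; last exact: h4.
by split; split=> [h|h]; auto.
Qed.
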